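(* Let $m\ge3$ be an odd integer and $n$ an integer with $2m<n$. Let $\lambda$ and $a$ be constants with $$\frac{2m+n-2}{n-2}<\lambda<\frac{n}{n-2m},\qquad a=\frac{4m(m-1)}{n-\lambda(n-2m)}.$$ Let $\varphi:(0,1)\to(0,1)$ be continuous with $\lim_{r\to0^+}\varphi(r)=0$. Then there exists a $C^\infty$ positive solution $u$ of $$0\le-\Delta^m u\le u^\lambda\quad\text{in }\mathbb{R}^n\setminus\{0\}$$ such that $u(x)\neq O(\varphi(|x|)|x|^{-a})$ as $x\to0$.
   Context: $\Delta^m$ is the $m$-fold iterated Laplacian. For positive functions, ''$u(x)\neq O(h(x))$ as $x\to0$'' means $\limsup_{x\to0} u(x)/h(x)=\infty$. *)

(* Defs.v *)
From Stdlib Require Import Reals Lra Lia Arith List.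
Open Scope R_scope.

Definition inRn (n : nat) (x : nat -> R) : Prop :=
  forall i, (n <= i)%nat -> x i = 0.

Fixpoint sumn_R (n : nat) (f : nat -> R) : R :=
  match n with
  | O => 0
  | S k => sumn_R k f + f k
  end.

Definition normn (n : nat) (x : nat -> R) : R :=
  sqrt (sumn_R n (fun i => x i ^ 2)).

Definition vsub (x y : nat -> R) : nat -> R := fun i => x i - y i.

Definition upd (x : nat -> R) (i : nat) (t : R) : nat -> R :=
  fun j => if Nat.eq_dec j i then t else x j.

Definition punct (n : nat) (x : nat -> R) : Prop :=
  inRn n x /\ 0 < normn n x.

Definition partial (n i : nat) (f g : (nat -> R) -> R) : Prop :=
  forall x, punct n x ->
    derivable_pt_lim (fun t => f (upd x i t)) (x i) (g x).

Inductive iter_partial (n : nat) (f : (nat -> R) -> R) :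
  list nat -> ((nat -> R) -> R) -> Prop :=
| ip_nil : iter_partial n f nil f
| ip_cons : forall i l g h,
    iter_partial n f l g -> partial n i g h -> iter_partial n f (i :: l) h.

Definition cont_on (n : nat) (g : (nat -> R) -> R) : Prop :=
  forall x, punct n x -> forall eps, 0 < eps ->
    exists delta, 0 < delta /\
      forall y, punct n y -> normn n (vsub y x) < delta ->
        Rabs (g y - g x) < eps.

Definition smooth_on (n : nat) (f : (nat -> R) -> R) : Prop :=
  forall l, Forall (fun i => (i < n)%nat) l ->
    exists g, iter_partial n f l g /\ cont_on n g.

Definition is_lap (n : nat) (f v : (nat -> R) -> R) : Prop :=
  exists d2 : nat -> (nat -> R) -> R,
    (forall i, (i < n)%nat ->
       exists d1, partial n i f d1 /\ partial n i d1 (d2 i)) /\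
    (forall x, punct n x -> v x = sumn_R n (fun i => d2 i x)).

Inductive iter_lap (n : nat) : nat -> ((nat -> R) -> R) -> ((nat -> R) -> R) -> Prop :=
| il_zero : forall f, iter_lap n O f f
| il_succ : forall k f g w, is_lap n f g -> iter_lap n k g w -> iter_lap n (S k) f w.

(* Main.v *)
Require Import Defs.
From Stdlib Require Import Reals Lra Lia Arith List.
From Stdlib Require Import FunctionalExtensionality IndefiniteDescription.
From Coquelicot Require Import Coquelicot.
Open Scope R_scope.

(** The solution is a background plus infinitely many bubbles,
    [u(x) = C1 + C2 |x|^(2-n) + sum_j A_j R_j(x)],  where  [s = (n-2m)/2],
    [F_j(x) = (|x - t_j e_0|^2 + r_j^2)^(-s)]  and  [R_j] is [F_j] minus its Taylor
    polynomial of degree [2m-3] in [t] along the ray [(t, r) = t (1, r_j / t_j)].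
    The conformal bubble satisfies
    [Delta^m F_j = (-4)^m s (s+1) ... (s+2m-1) r_j^(2m) (|x - t_j e_0|^2 + r_j^2)^(-s-2m)],
    which is negative for odd [m] and of order [t^(2m)] along the ray, so that the
    subtracted Taylor coefficients are polyharmonic away from the origin.

    By homogeneity [|R_j| <= C t_j^(2m-2) |x|^(2-n)] where [4 t_j <= |x|], and
    [R_j >= F_j - C t_j^(2m-2) |x|^(2-n)] elsewhere.  Hence with [A_j = 2^(-j-1) t_j^(2-2m)]
    the series converges with all its derivatives, and [u] is positive once [C2] is large.
    Choosing [r_j] with [r_j^(n - lam (n-2m)) = c A_j^(1-lam) 2^(j+1)] gives
    [-Delta^m (A_j F_j) <= 2^(-j-1) (A_j F_j)^lam], which bounds the [j]-th part of [-Delta^m u] by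
    [2^(-j-1) u^lam] where [|x| <= 4 t_j]; elsewhere the background does.  Finally
    [A_j F_j(t_j e_0) = k_j t_j^(-a)] with [k_j] independent of [t_j], so [t_j] can be chosen
    after [k_j] to beat [phi]. *)

(** * Finite sums, coordinates and the Euclidean norm *)

Lemma sumn_R_ext (n : nat) (f g : nat -> R) :
  (forall i, (i < n)%nat -> f i = g i) -> sumn_R n f = sumn_R n g.
Proof.
  induction n as [|n IH]; simpl; intros H; auto.
  rewrite IH, (H n) by auto with arith. reflexivity.
Qed.

Lemma sumn_R_0 (n : nat) (f : nat -> R) :
  (forall i, (i < n)%nat -> f i = 0) -> sumn_R n f = 0.
Proof.
  induction n as [|n IH]; simpl; intros H; auto.
  rewrite IH, (H n) by auto with arith. ring.
Qed.

Lemma sumn_R_add (n : nat) (f g : nat -> R) :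
  sumn_R n (fun i => f i + g i) = sumn_R n f + sumn_R n g.
Proof. induction n as [|n IH]; simpl; [ring | rewrite IH; ring]. Qed.

Lemma sumn_R_scal (n : nat) (c : R) (f : nat -> R) :
  sumn_R n (fun i => c * f i) = c * sumn_R n f.
Proof. induction n as [|n IH]; simpl; [ring | rewrite IH; ring]. Qed.

Lemma sumn_R_const (n : nat) (c : R) : sumn_R n (fun _ => c) = INR n * c.
Proof. induction n as [|n IH]; [simpl; ring | rewrite S_INR; simpl; rewrite IH; ring]. Qed.

Lemma sumn_R_le (n : nat) (f g : nat -> R) :
  (forall i, (i < n)%nat -> f i <= g i) -> sumn_R n f <= sumn_R n g.
Proof.
  induction n as [|n IH]; simpl; intros H; [lra|].
  apply Rplus_le_compat; auto with arith.
Qed.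

Lemma sumn_R_swap (n k : nat) (f : nat -> nat -> R) :
  sumn_R n (fun i => sumn_R k (f i)) = sumn_R k (fun j => sumn_R n (fun i => f i j)).
Proof.
  induction n as [|n IH]; simpl.
  - symmetry. now apply sumn_R_0.
  - now rewrite IH, sumn_R_add.
Qed.

Lemma sumn_R_derive (n : nat) (f f' : nat -> R -> R) (x : R) :
  (forall i, (i < n)%nat -> derivable_pt_lim (f i) x (f' i x)) ->
  derivable_pt_lim (fun y => sumn_R n (fun i => f i y)) x (sumn_R n (fun i => f' i x)).
Proof.
  induction n as [|n IH]; simpl; intros H; [apply derivable_pt_lim_const|].
  apply (derivable_pt_lim_plus (fun y => sumn_R n (fun i => f i y)) (f n)); auto with arith.
Qed.

Definition sq (n : nat) (x : nat -> R) : R := sumn_R n (fun i => x i ^ 2).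

Lemma sq_ge0 (n : nat) (x : nat -> R) : 0 <= sq n x.
Proof.
  unfold sq. rewrite <- (sumn_R_0 n (fun _ => 0)) by auto.
  apply sumn_R_le. intros; apply pow2_ge_0.
Qed.

Lemma normn_ge0 (n : nat) (x : nat -> R) : 0 <= normn n x.
Proof. apply sqrt_pos. Qed.

Lemma normn_sq (n : nat) (x : nat -> R) : normn n x ^ 2 = sq n x.
Proof. apply pow2_sqrt, sq_ge0. Qed.

Lemma punct_sq (n : nat) (x : nat -> R) : punct n x -> 0 < sq n x.
Proof. intros [_ H]. rewrite <- normn_sq. now apply pow_lt. Qed.

Lemma coord_le_normn (n i : nat) (x : nat -> R) : (i < n)%nat -> Rabs (x i) <= normn n x.
Proof.
  intros Hi. rewrite <- sqrt_Rsqr_abs. apply sqrt_le_1_alt. rewrite Rsqr_pow2.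
  induction n as [|n IH]; [lia|]. cbn [sumn_R].
  destruct (Nat.eq_dec i n) as [->|Hne].
  - generalize (sq_ge0 n x). unfold sq. lra.
  - specialize (IH ltac:(lia)). generalize (pow2_ge_0 (x n)). lra.
Qed.

Lemma upd_same (x : nat -> R) (i : nat) (t : R) : upd x i t i = t.
Proof. unfold upd. destruct (Nat.eq_dec i i); congruence. Qed.

Lemma upd_other (x : nat -> R) (i j : nat) (t : R) : j <> i -> upd x i t j = x j.
Proof. unfold upd. destruct (Nat.eq_dec j i); congruence. Qed.

Lemma upd_id (x : nat -> R) (i : nat) : upd x i (x i) = x.
Proof.
  apply functional_extensionality; intros j. unfold upd.
  destruct (Nat.eq_dec j i); congruence.
Qed.

Lemma upd_upd (x : nat -> R) (i : nat) (s t : R) : upd (upd x i s) i t = upd x i t.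
Proof.
  apply functional_extensionality; intros j. unfold upd.
  destruct (Nat.eq_dec j i); congruence.
Qed.

Lemma sq_upd (n i : nat) (x : nat -> R) (y : R) :
  (i < n)%nat -> sq n (upd x i y) = sq n x + y ^ 2 - x i ^ 2.
Proof.
  intros Hi. unfold sq. induction n as [|n IH]; [lia|]. cbn [sumn_R].
  destruct (Nat.eq_dec i n) as [->|Hne].
  - rewrite upd_same. rewrite (sumn_R_ext n _ (fun i => x i ^ 2)); [ring|].
    intros j Hj. rewrite upd_other by lia. reflexivity.
  - rewrite IH by lia. rewrite (upd_other x i n) by lia. ring.
Qed.

Lemma inRn_upd (n i : nat) (x : nat -> R) (y : R) :
  (i < n)%nat -> inRn n x -> inRn n (upd x i y).
Proof. intros Hi Hx j Hj. rewrite upd_other by lia. now apply Hx. Qed.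

(** The inequality [|a + b|^2 <= 2 |a|^2 + 2 |b|^2] stands in for the triangle inequality: with
    [|z - x| <= |x| / 2] it yields [|x|^2 / 4 <= |z|^2 <= 5 |x|^2 / 2]. *)
Lemma normn_near (n : nat) (x z : nat -> R) (delta : R) :
  0 < normn n x -> delta <= normn n x / 2 ->
  sq n (vsub z x) <= delta ^ 2 -> 0 <= delta ->
  normn n x / 2 <= normn n z <= 2 * normn n x.
Proof.
  intros Hx Hd Hz Hd0.
  assert (H1 : sq n z <= 2 * sq n x + 2 * sq n (vsub z x)).
  { unfold sq. rewrite <- !sumn_R_scal, <- sumn_R_add. apply sumn_R_le.
    intros i _. unfold vsub. generalize (pow2_ge_0 (2 * x i - z i)). nra. }
  assert (H2 : sq n x <= 2 * sq n z + 2 * sq n (vsub z x)).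
  { unfold sq. rewrite <- !sumn_R_scal, <- sumn_R_add. apply sumn_R_le.
    intros i _. unfold vsub. generalize (pow2_ge_0 (2 * z i - x i)). nra. }
  rewrite <- (normn_sq n x), <- (normn_sq n z) in H1, H2.
  generalize (normn_ge0 n z); intros H3. split; nra.
Qed.

Ltac change_R := lazymatch goal with |- @eq _ ?a ?b => change (@eq R a b) end.

(** * Formal expressions in the bubble and their derivatives *)

(* [ET] is the parameter [t], [EP] is [1 + (r/t)^2], constant along the ray, and [EPow sigma]
   is [Q^(-sigma)] for [Q = |x - t e_0|^2 + r^2 = |x|^2 - 2 t x_0 + p t^2].  The syntax gives
   commuting derivatives of every order, each again of the same form. *)
Inductive expr : Type :=
| ECst (c : R)
| EX (i : nat)
| ET
| EP
| EPow (sigma : R)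
| EAdd (e1 e2 : expr)
| EMul (e1 e2 : expr).

Inductive dir : Type := DX (i : nat) | DT.

Definition quad (n : nat) (x : nat -> R) (t p : R) : R :=
  sq n x - 2 * t * x 0%nat + p * t ^ 2.

Fixpoint ev (n : nat) (x : nat -> R) (t p : R) (e : expr) : R :=
  match e with
  | ECst c => c
  | EX i => x i
  | ET => t
  | EP => p
  | EPow sigma => Rpower (quad n x t p) (- sigma)
  | EAdd e1 e2 => ev n x t p e1 + ev n x t p e2
  | EMul e1 e2 => ev n x t p e1 * ev n x t p e2
  end.

Definition kron (i j : nat) : R := if Nat.eq_dec i j then 1 else 0.

Definition equad_deriv (v : dir) : expr :=
  match v with
  | DX i => EAdd (EMul (ECst 2) (EX i)) (EMul (ECst (-2 * kron i 0)) ET)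
  | DT => EAdd (EMul (ECst (-2)) (EX 0)) (EMul (ECst 2) (EMul EP ET))
  end.

Fixpoint ederiv (v : dir) (e : expr) : expr :=
  match e with
  | ECst _ => ECst 0
  | EX j => match v with DX i => ECst (kron i j) | DT => ECst 0 end
  | ET => match v with DX _ => ECst 0 | DT => ECst 1 end
  | EP => ECst 0
  | EPow sigma => EMul (EMul (ECst (- sigma)) (equad_deriv v)) (EPow (sigma + 1))
  | EAdd e1 e2 => EAdd (ederiv v e1) (ederiv v e2)
  | EMul e1 e2 => EAdd (EMul (ederiv v e1) e2) (EMul e1 (ederiv v e2))
  end.

(** The difference of the two sides is [|x - t e_0|^2], which is at least [(x_0 - t)^2]. *)
Lemma quad_bubble (n : nat) (x : nat -> R) (t p : R) :
  (0 < n)%nat -> (p - 1) * t ^ 2 <= quad n x t p.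
Proof.
  intros Hn. unfold quad.
  generalize (coord_le_normn n 0 x Hn), (normn_sq n x), (pow2_ge_0 (x 0%nat - t)); intros H1 H2 H3.
  assert (H4 : x 0%nat ^ 2 <= normn n x ^ 2).
  { rewrite <- (pow2_abs (x 0%nat)). apply pow_incr. split; [apply Rabs_pos | exact H1]. }
  nra.
Qed.

(** Completing the square in [t], the minimum of [Q] over all real [t] is [|x|^2 - x_0^2 / p]. Hence
    [Q] is positive off the origin even at [t = 0], where the Taylor expansion is centred. *)
Lemma quad_ge_sq (n : nat) (x : nat -> R) (t p : R) :
  (0 < n)%nat -> 1 < p -> (1 - / p) * sq n x <= quad n x t p.
Proof.
  intros Hn Hp. unfold quad.
  generalize (coord_le_normn n 0 x Hn), (normn_sq n x), (pow2_ge_0 (x 0%nat - p * t)); intros H1 H2 H3.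
  assert (H4 : x 0%nat ^ 2 <= sq n x).
  { rewrite <- H2, <- (pow2_abs (x 0%nat)). apply pow_incr. split; [apply Rabs_pos | exact H1]. }
  apply Rmult_le_reg_l with p; [lra|].
  replace (p * ((1 - / p) * sq n x)) with ((p - 1) * sq n x) by (field; lra).
  nra.
Qed.

Lemma quad_pos (n : nat) (x : nat -> R) (t p : R) :
  (0 < n)%nat -> punct n x -> 1 < p -> 0 < quad n x t p.
Proof.
  intros Hn Hx Hp. apply Rlt_le_trans with ((1 - / p) * sq n x).
  - apply Rmult_lt_0_compat; [|now apply punct_sq].
    assert (/ p < 1) by (rewrite <- Rinv_1; apply Rinv_lt_contravar; lra). lra.
  - now apply quad_ge_sq.
Qed.

Lemma quad_t0 (n : nat) (x : nat -> R) (p : R) : quad n x 0 p = sq n x.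
Proof. unfold quad. ring. Qed.

Lemma derivable_pt_lim_eq (f : R -> R) (x l l' : R) :
  derivable_pt_lim f x l -> l = l' -> derivable_pt_lim f x l'.
Proof. now intros H <-. Qed.

Lemma quad_dx (n i : nat) (x : nat -> R) (t p : R) :
  (i < n)%nat ->
  derivable_pt_lim (fun y => quad n (upd x i y) t p) (x i) (ev n x t p (equad_deriv (DX i))).
Proof.
  intros Hi.
  apply is_derive_Reals.
  apply is_derive_ext with
    (f := fun y => sq n x + y ^ 2 - x i ^ 2 - 2 * t * (kron i 0 * y + (1 - kron i 0) * x 0%nat) + p * t ^ 2).
  - intros y. unfold quad. rewrite sq_upd by auto. unfold kron, upd.
    destruct (Nat.eq_dec i 0) as [->|H0].
    + destruct (Nat.eq_dec 0 0); [change_R; ring | congruence].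
    + destruct (Nat.eq_dec 0 i); [congruence | change_R; ring].
  - auto_derive; auto. simpl. ring.
Qed.

Lemma quad_dt (n : nat) (x : nat -> R) (t p : R) :
  derivable_pt_lim (fun t => quad n x t p) t (ev n x t p (equad_deriv DT)).
Proof.
  unfold quad. apply is_derive_Reals. auto_derive; auto. simpl. ring.
Qed.

Lemma ev_dx (n i : nat) (x : nat -> R) (t p : R) (e : expr) :
  (i < n)%nat -> 0 < quad n x t p ->
  derivable_pt_lim (fun y => ev n (upd x i y) t p e) (x i) (ev n x t p (ederiv (DX i) e)).
Proof.
  intros Hi HQ. induction e as [c|j| | |sigma|e1 IH1 e2 IH2|e1 IH1 e2 IH2]; cbn [ev ederiv].
  - apply derivable_pt_lim_const.
  - unfold upd, kron. destruct (Nat.eq_dec j i) as [->|H].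
    + destruct (Nat.eq_dec i i); [apply derivable_pt_lim_id | congruence].
    + destruct (Nat.eq_dec i j); [congruence | apply derivable_pt_lim_const].
  - apply derivable_pt_lim_const.
  - apply derivable_pt_lim_const.
  - eapply derivable_pt_lim_eq.
    + apply (derivable_pt_lim_comp (fun y => quad n (upd x i y) t p) (fun z => Rpower z (- sigma))).
      * apply (quad_dx n i x t p Hi).
      * rewrite upd_id. now apply derivable_pt_lim_power.
    + replace (- sigma - 1) with (- (sigma + 1)) by ring. ring.
  - now apply (derivable_pt_lim_plus _ _ _ _ _ IH1 IH2).
  - generalize (derivable_pt_lim_mult _ _ _ _ _ IH1 IH2). cbv beta. now rewrite upd_id.
Qed.

Lemma ev_dt (n : nat) (x : nat -> R) (t p : R) (e : expr) :
  0 < quad n x t p ->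
  derivable_pt_lim (fun t => ev n x t p e) t (ev n x t p (ederiv DT e)).
Proof.
  intros HQ. induction e as [c|j| | |sigma|e1 IH1 e2 IH2|e1 IH1 e2 IH2]; cbn [ev ederiv].
  - apply derivable_pt_lim_const.
  - apply derivable_pt_lim_const.
  - apply derivable_pt_lim_id.
  - apply derivable_pt_lim_const.
  - eapply derivable_pt_lim_eq.
    + apply (derivable_pt_lim_comp (fun t => quad n x t p) (fun z => Rpower z (- sigma))).
      * apply quad_dt.
      * now apply derivable_pt_lim_power.
    + replace (- sigma - 1) with (- (sigma + 1)) by ring. ring.
  - now apply (derivable_pt_lim_plus _ _ _ _ _ IH1 IH2).
  - now apply (derivable_pt_lim_mult _ _ _ _ _ IH1 IH2).
Qed.

Definition valid_dir (n : nat) (v : dir) : Prop :=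
  match v with DX i => (i < n)%nat | DT => True end.

(** Agreement on a set that is open in [x] and unrestricted in [t], so that it survives
    differentiation in every direction; there [Q] is positive. *)
Definition eqv (n : nat) (e e' : expr) : Prop :=
  forall x t p, punct n x -> 1 < p -> ev n x t p e = ev n x t p e'.

Lemma derivable_pt_lim_locally_ext (f g : R -> R) (x l delta : R) :
  0 < delta -> (forall y, Rabs (y - x) < delta -> f y = g y) ->
  derivable_pt_lim f x l -> derivable_pt_lim g x l.
Proof.
  intros Hd H Hf. apply is_derive_Reals. apply is_derive_Reals in Hf.
  apply is_derive_ext_loc with f; auto.
  exists (mkposreal delta Hd). intros y Hy. apply H. exact Hy.
Qed.

Lemma punct_line (n i : nat) (x : nat -> R) (y delta : R) :
  (i < n)%nat -> punct n x -> delta <= normn n x / 2 -> Rabs (y - x i) <= delta ->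
  punct n (upd x i y) /\ normn n x / 2 <= normn n (upd x i y) <= 2 * normn n x.
Proof.
  intros Hi [Hx Hx0] Hd Hy. generalize (Rabs_pos (y - x i)); intros Hp.
  assert (H : normn n x / 2 <= normn n (upd x i y) <= 2 * normn n x).
  { apply normn_near with delta; auto; [|lra].
    replace (vsub (upd x i y) x) with (upd (fun _ => 0) i (y - x i)).
    - rewrite sq_upd by auto. unfold sq at 1. rewrite sumn_R_0 by (intros; simpl; ring).
      rewrite <- (pow2_abs (y - x i)). nra.
    - apply functional_extensionality; intros j. unfold vsub, upd.
      destruct (Nat.eq_dec j i) as [->|]; ring. }
  split; auto. split; [now apply inRn_upd | lra].
Qed.

(** The formal derivatives are true derivatives of locally equal functions, so uniqueness of the
    limit identifies them. *)
Lemma eqv_ed (n : nat) (v : dir) (e e' : expr) :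
  (0 < n)%nat -> valid_dir n v -> eqv n e e' -> eqv n (ederiv v e) (ederiv v e').
Proof.
  intros Hn Hv H x t p Hx Hp. pose proof (quad_pos n x t p Hn Hx Hp) as HQ.
  destruct v as [i|]; simpl in Hv.
  - eapply uniqueness_limite; [apply (ev_dx n i x t p e Hv HQ)|].
    apply derivable_pt_lim_locally_ext with (f := fun y => ev n (upd x i y) t p e')
      (delta := normn n x / 2).
    + destruct Hx; lra.
    + intros y Hy. symmetry. apply H; auto.
      apply (punct_line n i x y (normn n x / 2)); auto; lra.
    + now apply ev_dx.
  - eapply uniqueness_limite; [apply (ev_dt n x t p e HQ)|].
    apply derivable_pt_lim_locally_ext with (f := fun t => ev n x t p e') (delta := 1); [lra| |].
    + intros y _. symmetry. now apply H.
    + now apply ev_dt.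
Qed.

Lemma ev_ed_dq (n : nat) (x : nat -> R) (t p : R) (v w : dir) :
  ev n x t p (ederiv v (equad_deriv w)) = ev n x t p (ederiv w (equad_deriv v)).
Proof.
  destruct v as [i|], w as [j|]; simpl; try ring.
  unfold kron. destruct (Nat.eq_dec i j), (Nat.eq_dec j i); try congruence; ring.
Qed.

(** Symmetry of mixed derivatives follows by structural induction; for a power of [Q] it reduces to
    the symmetry of the Hessian of [Q] in [(x, t)]. *)
Lemma ev_ed_comm (n : nat) (x : nat -> R) (t p : R) (v w : dir) (e : expr) :
  ev n x t p (ederiv v (ederiv w e)) = ev n x t p (ederiv w (ederiv v e)).
Proof.
  induction e as [c|j| | |sigma|e1 IH1 e2 IH2|e1 IH1 e2 IH2]; cbn [ev ederiv]; auto.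
  - destruct v, w; reflexivity.
  - destruct v, w; reflexivity.
  - rewrite (ev_ed_dq n x t p v w). ring.
  - congruence.
  - rewrite IH1, IH2. ring.
Qed.

Definition ederiv_t (k : nat) (e : expr) : expr := Nat.iter k (ederiv DT) e.

Lemma edt_S (k : nat) (e : expr) : ederiv_t (S k) e = ederiv DT (ederiv_t k e).
Proof. reflexivity. Qed.

Lemma eqv_edt (n k : nat) (e e' : expr) :
  (0 < n)%nat -> eqv n e e' -> eqv n (ederiv_t k e) (ederiv_t k e').
Proof. intros Hn H. induction k; simpl; auto. now apply eqv_ed. Qed.

Lemma edt_ed_comm (n k : nat) (v : dir) (e : expr) :
  (0 < n)%nat -> eqv n (ederiv_t k (ederiv v e)) (ederiv v (ederiv_t k e)).
Proof.
  intros Hn. induction k as [|k IH]; [now intros x t p|].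
  intros x t p Hx Hp. rewrite !edt_S, <- (ev_ed_comm n x t p DT v).
  now apply (eqv_ed n DT).
Qed.

(* Homogeneity in [(x, t)]. *)
Inductive hom : expr -> R -> Prop :=
| hom_0 d : hom (ECst 0) d
| hom_cst c : hom (ECst c) 0
| hom_X i : hom (EX i) 1
| hom_T : hom ET 1
| hom_P : hom EP 0
| hom_Pow sigma : 0 < sigma -> hom (EPow sigma) (- 2 * sigma)
| hom_Add e1 e2 d : hom e1 d -> hom e2 d -> hom (EAdd e1 e2) d
| hom_Mul e1 e2 d1 d2 d : hom e1 d1 -> hom e2 d2 -> d = d1 + d2 -> hom (EMul e1 e2) d.

Lemma hom_eq (e : expr) (d d' : R) : hom e d -> d = d' -> hom e d'.
Proof. now intros H <-. Qed.

Lemma hom_dq (v : dir) : hom (equad_deriv v) 1.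
Proof.
  destruct v; simpl; apply hom_Add; repeat (econstructor; try reflexivity); ring.
Qed.

(** The constant zero has every degree, so the zero terms produced by [ederiv] fit into a sum of any
    degree. The exponent [sigma] only grows, hence stays positive. *)
Lemma hom_ed (v : dir) (e : expr) (d : R) : hom e d -> hom (ederiv v e) (d - 1).
Proof.
  induction 1 as [d|c|i| | |sigma Hs|e1 e2 d H1 IH1 H2 IH2|e1 e2 d1 d2 d H1 IH1 H2 IH2 Hd];
    cbn [ederiv]; try apply hom_0.
  - destruct v; [apply hom_eq with 0; [apply hom_cst | ring] | apply hom_0].
  - destruct v; [apply hom_0 | apply hom_eq with 0; [apply hom_cst | ring]].
  - apply hom_Mul with 1 (-2 * (sigma + 1)); [|apply hom_Pow; lra|ring].
    apply hom_Mul with 0 1; [apply hom_cst | apply hom_dq | ring].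
  - now apply hom_Add.
  - apply hom_Add; [apply hom_Mul with (d1 - 1) d2 | apply hom_Mul with d1 (d2 - 1)]; auto; lra.
Qed.

Lemma hom_edt (k : nat) (e : expr) (d : R) : hom e d -> hom (ederiv_t k e) (d - INR k).
Proof.
  intros H. induction k as [|k IH]; [apply hom_eq with d; [exact H | simpl; ring]|].
  rewrite edt_S. apply hom_eq with (d - INR k - 1); [now apply hom_ed | rewrite S_INR; ring].
Qed.

(** * Size of homogeneous expressions *)

Lemma Rpower_pos (x y : R) : 0 < Rpower x y.
Proof. apply exp_pos. Qed.

Lemma Rpower_le_neg (a b c : R) : 0 < a <= b -> 0 <= c -> Rpower b (- c) <= Rpower a (- c).
Proof.
  intros Hab Hc. rewrite !Rpower_Ropp. apply Rinv_le_contravar; [apply Rpower_pos|].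
  apply Rle_Rpower_l; lra.
Qed.

Lemma Rpower_sqr (x y : R) : 0 < x -> Rpower (x ^ 2) y = Rpower x (2 * y).
Proof. intros Hx. rewrite <- (Rpower_pow 2 x Hx), Rpower_mult. reflexivity. Qed.

(** Where [Q >= kappa |x|^2] and [|t| <= tau |x|], each atom is bounded by a multiple of [|x|] to
    its degree, and the bounds add and multiply. Powers of [Q] are negative, so only a lower bound
    on [Q] enters. The constant is uniform in [p]. *)
Lemma hom_bound (n : nat) (e : expr) (d kappa tau : R) :
  hom e d -> 0 < kappa -> 0 <= tau ->
  exists M, 0 <= M /\ forall x t p, punct n x -> 1 <= p <= 2 ->
    kappa * sq n x <= quad n x t p -> Rabs t <= tau * normn n x ->
    Rabs (ev n x t p e) <= M * Rpower (normn n x) d.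
Proof.
  intros H Hk Ht.
  induction H as [d|c|i| | |sigma Hs|e1 e2 d H1 IH1 H2 IH2|e1 e2 d1 d2 d H1 IH1 H2 IH2 Hd].
  - exists 0. split; [lra|]. intros. simpl. rewrite Rabs_R0. lra.
  - exists (Rabs c). split; [apply Rabs_pos|]. intros x t p [_ Hx] _ _ _. simpl.
    rewrite Rpower_O by exact Hx. lra.
  - exists 1. split; [lra|]. intros x t p [Hin Hx] _ _ _. simpl.
    rewrite Rpower_1 by exact Hx. rewrite Rmult_1_l.
    destruct (Nat.lt_ge_cases i n) as [Hi|Hi]; [now apply coord_le_normn|].
    rewrite (Hin i Hi), Rabs_R0. lra.
  - exists tau. split; [lra|]. intros x t p [Hin Hx] _ _ HT. simpl.
    now rewrite Rpower_1.
  - exists 2. split; [lra|]. intros x t p [Hin Hx] Hp _ _. simpl.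
    rewrite Rpower_O by exact Hx. rewrite Rabs_pos_eq; lra.
  - exists (Rpower kappa (- sigma)). split; [left; apply Rpower_pos|].
    intros x t p Hx _ HQ _. simpl. rewrite Rabs_pos_eq by (left; apply Rpower_pos).
    replace (- 2 * sigma) with (2 * - sigma) by ring.
    rewrite <- Rpower_sqr by (apply Hx). rewrite normn_sq, Rpower_mult_distr; auto using punct_sq.
    apply Rpower_le_neg; [|lra]. split; auto. apply Rmult_lt_0_compat; auto using punct_sq.
  - destruct IH1 as (M1 & HM1 & B1), IH2 as (M2 & HM2 & B2).
    exists (M1 + M2). split; [lra|]. intros x t p Hx Hp HQ HT. simpl.
    eapply Rle_trans; [apply Rabs_triang|]. rewrite Rmult_plus_distr_r.
    apply Rplus_le_compat; auto.
  - destruct IH1 as (M1 & HM1 & B1), IH2 as (M2 & HM2 & B2).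
    exists (M1 * M2). split; [now apply Rmult_le_pos|]. intros x t p Hx Hp HQ HT. simpl.
    rewrite Rabs_mult, Hd, Rpower_plus.
    replace (M1 * M2 * (Rpower (normn n x) d1 * Rpower (normn n x) d2)) with
      ((M1 * Rpower (normn n x) d1) * (M2 * Rpower (normn n x) d2)) by ring.
    apply Rmult_le_compat; auto using Rabs_pos.
Qed.

(** * Taylor remainders in the parameter *)

(** The bound on [f'] is asked only up to the distance of [y]: in the Taylor induction it grows with
    that distance. *)
Lemma mvt_bound (f f' : R -> R) (x y M r : R) :
  (forall z, Rabs (z - x) <= r -> derivable_pt_lim f z (f' z)) ->
  (forall z, Rabs (z - x) <= Rabs (y - x) -> Rabs (f' z) <= M) ->
  Rabs (y - x) <= r -> Rabs (f y - f x) <= M * Rabs (y - x).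
Proof.
  intros Hd Hb Hy.
  assert (Hin : forall z, Rmin x y <= z <= Rmax x y -> Rabs (z - x) <= Rabs (y - x)).
  { intros z. unfold Rmin, Rmax. destruct (Rle_dec x y); intros Hz;
      unfold Rabs; repeat destruct Rcase_abs; lra. }
  destruct (MVT_gen f x y f') as (c & Hc & E).
  - intros z Hz. apply is_derive_Reals. apply Hd.
    eapply Rle_trans; [apply Hin; lra | exact Hy].
  - intros z Hz. apply derivable_continuous_pt. exists (f' z). apply Hd.
    eapply Rle_trans; [apply Hin; lra | exact Hy].
  - rewrite E, Rabs_mult. apply Rmult_le_compat_r; [apply Rabs_pos|]. now apply Hb, Hin.
Qed.

Lemma taylor_poly_derive (K : nat) (c : nat -> R) (x y : R) :
  derivable_pt_lim (fun y => sumn_R (S K) (fun k => (y - x) ^ k / INR (fact k) * c k)) y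
    (sumn_R K (fun k => (y - x) ^ k / INR (fact k) * c (S k))).
Proof.
  induction K as [|K IH].
  - cbn [sumn_R]. apply is_derive_Reals. auto_derive; auto. change_R. ring.
  - change (derivable_pt_lim (fun y => sumn_R (S K) (fun k => (y - x) ^ k / INR (fact k) * c k) +
      (y - x) ^ S K / INR (fact (S K)) * c (S K)) y
      (sumn_R K (fun k => (y - x) ^ k / INR (fact k) * c (S k)) +
       (y - x) ^ K / INR (fact K) * c (S K))).
    apply (derivable_pt_lim_plus _ _ _ _ _ IH).
    assert (E : INR (fact (S K)) = INR (S K) * INR (fact K)) by (rewrite <- mult_INR; reflexivity).
    generalize (INR_fact_neq_0 K), (not_0_INR (S K) (Nat.neq_succ_0 K)); intros HF HS.
    revert E. generalize (INR (fact (S K))); intros F E.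
    apply is_derive_Reals. auto_derive; auto. change_R.
    rewrite E. change (Nat.pred (S K)) with K.
    change (match K with O => 1 | S _ => INR K + 1 end) with (INR (S K)).
    unfold Rminus. field. auto.
Qed.

Lemma taylor_poly_center (K : nat) (c : nat -> R) (x : R) :
  sumn_R (S K) (fun k => (x - x) ^ k / INR (fact k) * c k) = c O.
Proof.
  induction K as [|K IH]; [simpl; field|].
  change (sumn_R (S K) (fun k => (x - x) ^ k / INR (fact k) * c k) +
    (x - x) ^ S K / INR (fact (S K)) * c (S K) = c O).
  rewrite IH, Rminus_diag. simpl pow. unfold Rdiv. ring.
Qed.

(** Induction on [K]: the remainder vanishes at [x], and its derivative is the previous remainder
    for the shifted sequence [g (S k)]. The mean value theorem then gains one factor [|y - x|]; the
    factor [1 / K!] is given up. *)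
Lemma taylor_bound (K : nat) (g : nat -> R -> R) (x y M r : R) :
  (forall k z, (k < K)%nat -> Rabs (z - x) <= r -> derivable_pt_lim (g k) z (g (S k) z)) ->
  (forall z, Rabs (z - x) <= r -> Rabs (g K z) <= M) ->
  Rabs (y - x) <= r ->
  Rabs (g O y - sumn_R K (fun k => (y - x) ^ k / INR (fact k) * g k x)) <= M * Rabs (y - x) ^ K.
Proof.
  revert g y. induction K as [|K IH]; intros g y Hd Hb Hy.
  - cbn [sumn_R]. rewrite Rminus_0_r. simpl. rewrite Rmult_1_r. now apply Hb.
  - set (h := fun y => g O y - sumn_R (S K) (fun k => (y - x) ^ k / INR (fact k) * g k x)).
    change (Rabs (h y) <= M * Rabs (y - x) ^ S K).
    assert (Hx : h x = 0).
    { unfold h. rewrite (taylor_poly_center K (fun k => g k x)). ring. }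
    replace (h y) with (h y - h x) by (rewrite Hx; ring).
    replace (M * Rabs (y - x) ^ S K) with (M * Rabs (y - x) ^ K * Rabs (y - x)) by (simpl; ring).
    assert (HM : 0 <= M) by (eapply Rle_trans; [apply Rabs_pos | now apply (Hb y)]).
    apply mvt_bound with (r := r)
      (f' := fun z => g 1%nat z - sumn_R K (fun k => (z - x) ^ k / INR (fact k) * g (S k) x)); auto.
    + intros z Hz. apply (derivable_pt_lim_minus (g O)).
      * apply Hd; auto with arith.
      * apply (taylor_poly_derive K (fun k => g k x)).
    + intros z Hz. eapply Rle_trans.
      * apply (IH (fun k => g (S k))); [| |lra].
        -- intros k w Hk Hw. apply Hd; auto with arith.
        -- intros w Hw. now apply Hb.
      * apply Rmult_le_compat_l; auto. apply pow_incr. split; [apply Rabs_pos | lra].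
Qed.

Definition taylor_part (n K : nat) (x : nat -> R) (t p : R) (e : expr) : R :=
  sumn_R K (fun k => t ^ k / INR (fact k) * ev n x 0 p (ederiv_t k e)).

Definition remainder (n K : nat) (x : nat -> R) (t p : R) (e : expr) : R :=
  ev n x t p e - taylor_part n K x t p e.

(** The Taylor coefficients are derivatives in [t], which commute with those in [x]; so the
    derivative of a remainder is the remainder of the derivative. *)
Lemma rem_dx (n K i : nat) (x : nat -> R) (t p : R) (e : expr) :
  (i < n)%nat -> punct n x -> 1 < p ->
  derivable_pt_lim (fun y => remainder n K (upd x i y) t p e) (x i) (remainder n K x t p (ederiv (DX i) e)).
Proof.
  intros Hi Hx Hp. assert (Hn : (0 < n)%nat) by lia.
  apply (derivable_pt_lim_minus (fun y => ev n (upd x i y) t p e)).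
  - apply ev_dx; auto. now apply quad_pos.
  - apply (sumn_R_derive K (fun k y => t ^ k / INR (fact k) * ev n (upd x i y) 0 p (ederiv_t k e))
      (fun k _ => t ^ k / INR (fact k) * ev n x 0 p (ederiv_t k (ederiv (DX i) e)))).
    intros k _. rewrite edt_ed_comm by auto.
    apply (derivable_pt_lim_scal (fun y => ev n (upd x i y) 0 p (ederiv_t k e))).
    apply ev_dx; auto. now apply quad_pos.
Qed.

Lemma rem_eqv (n K : nat) (x : nat -> R) (t p : R) (e e' : expr) :
  (0 < n)%nat -> eqv n e e' -> punct n x -> 1 < p -> remainder n K x t p e = remainder n K x t p e'.
Proof.
  intros Hn H Hx Hp. unfold remainder, taylor_part. rewrite (H x t p Hx Hp). f_equal.
  apply sumn_R_ext; intros k _. now rewrite (eqv_edt n k e e' Hn H x 0 p Hx Hp).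
Qed.

Fixpoint esum (k : nat) (f : nat -> expr) : expr :=
  match k with O => ECst 0 | S k => EAdd (esum k f) (f k) end.

Lemma ev_esum (n : nat) (x : nat -> R) (t p : R) (k : nat) (f : nat -> expr) :
  ev n x t p (esum k f) = sumn_R k (fun i => ev n x t p (f i)).
Proof. induction k as [|k IH]; simpl; auto. now rewrite IH. Qed.

Lemma ed_esum (v : dir) (k : nat) (f : nat -> expr) :
  ederiv v (esum k f) = esum k (fun i => ederiv v (f i)).
Proof. induction k as [|k IH]; simpl; auto. now rewrite IH. Qed.

Lemma edt_esum (j k : nat) (f : nat -> expr) :
  ederiv_t j (esum k f) = esum k (fun i => ederiv_t j (f i)).
Proof. induction j as [|j IH]; auto. now rewrite edt_S, IH, ed_esum. Qed.

Lemma hom_esum (k : nat) (f : nat -> expr) (d : R) :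
  (forall i, (i < k)%nat -> hom (f i) d) -> hom (esum k f) d.
Proof. induction k as [|k IH]; simpl; intros H; constructor; auto. Qed.

Lemma rem_esum (n K : nat) (x : nat -> R) (t p : R) (k : nat) (f : nat -> expr) :
  remainder n K x t p (esum k f) = sumn_R k (fun i => remainder n K x t p (f i)).
Proof.
  unfold remainder, taylor_part. rewrite ev_esum.
  rewrite (sumn_R_ext K _ (fun j => sumn_R k (fun i => t ^ j / INR (fact j) * ev n x 0 p (ederiv_t j (f i))))).
  - rewrite <- (sumn_R_swap k K (fun i j => t ^ j / INR (fact j) * ev n x 0 p (ederiv_t j (f i)))).
    induction k as [|k IH]; simpl; [ring | rewrite <- IH; ring].
  - intros j _. now rewrite edt_esum, ev_esum, sumn_R_scal.
Qed.

(** For [|z| <= t <= |x| / 4] the cross term satisfies [2 z x_0 <= |x|^2 / 2], hence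
    [Q >= |x|^2 / 2] along the whole expansion interval. The [K]-th derivative in [t] has degree
    [d - K], and Taylor's estimate supplies [t^K]. *)
Lemma rem_far (n K : nat) (e : expr) (d : R) :
  (0 < n)%nat -> hom e d ->
  exists M, 0 <= M /\ forall x t p, punct n x -> 1 < p <= 2 -> 0 <= t -> 4 * t <= normn n x ->
    Rabs (remainder n K x t p e) <= M * t ^ K * Rpower (normn n x) (d - INR K).
Proof.
  intros Hn H.
  destruct (hom_bound n (ederiv_t K e) (d - INR K) (1/2) (1/4)) as (M & HM & B);
    [now apply hom_edt | lra | lra |].
  exists M. split; auto. intros x t p Hx Hp Ht Htx.
  assert (HB : forall z, Rabs (z - 0) <= t ->
            Rabs (ev n x z p (ederiv_t K e)) <= M * Rpower (normn n x) (d - INR K)).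
  { intros z. rewrite Rminus_0_r. intros Hz. apply B; auto; try lra.
    unfold quad. generalize (coord_le_normn n 0 x Hn); intros H1.
    assert (H2 : z * x 0%nat <= normn n x / 4 * normn n x).
    { eapply Rle_trans; [apply Rle_abs|]. rewrite Rabs_mult.
      apply Rmult_le_compat; auto using Rabs_pos; lra. }
    generalize (normn_sq n x), (pow2_ge_0 z); nra. }
  unfold remainder, taylor_part.
  generalize (taylor_bound K (fun k z => ev n x z p (ederiv_t k e)) 0 t
    (M * Rpower (normn n x) (d - INR K)) t).
  rewrite !Rminus_0_r. cbv beta. rewrite (Rabs_pos_eq t Ht). intros HT.
  replace (M * t ^ K * Rpower (normn n x) (d - INR K))
    with (M * Rpower (normn n x) (d - INR K) * t ^ K) by ring.
  apply HT; auto; [|lra].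
  intros k z _ _. apply (ev_dt n x z p (ederiv_t k e)). apply quad_pos; auto; lra.
Qed.

(** The [k]-th term is of order [t^k |x|^(d-k) = t^K |x|^(d-K) (|x| / t)^(K-k)], and [|x| / t <= 4].
    The same right-hand side as in [rem_far] thus controls the subtracted polynomial near the
    bubble. *)
Lemma tay_near (n K : nat) (e : expr) (d : R) :
  hom e d ->
  exists M, 0 <= M /\ forall x t p, punct n x -> 1 < p <= 2 -> normn n x <= 4 * t ->
    Rabs (taylor_part n K x t p e) <= M * t ^ K * Rpower (normn n x) (d - INR K).
Proof.
  intros H.
  assert (G : forall J, (J <= K)%nat ->
    exists M, 0 <= M /\ forall x t p, punct n x -> 1 < p <= 2 -> normn n x <= 4 * t ->
    Rabs (taylor_part n J x t p e) <= M * t ^ K * Rpower (normn n x) (d - INR K)); [|now apply G].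
  induction J as [|J IH]; intros HJ.
  - exists 0. split; [lra|]. intros. unfold taylor_part. simpl. rewrite Rabs_R0. lra.
  - destruct IH as (M & HM & B); [lia|].
    destruct (hom_bound n (ederiv_t J e) (d - INR J) 1 0) as (M' & HM' & B');
      [now apply hom_edt | lra | lra |].
    exists (M + M' * 4 ^ (K - J)). split.
    { apply Rplus_le_le_0_compat; auto. apply Rmult_le_pos; auto. apply pow_le; lra. }
    intros x t p Hx Hp Htx. pose proof Hx as [_ Hx0].
    unfold taylor_part in *. cbn [sumn_R]. eapply Rle_trans; [apply Rabs_triang|].
    rewrite !Rmult_plus_distr_r. apply Rplus_le_compat; auto.
    assert (Hf : 0 < / INR (fact J) <= 1).
    { generalize (lt_O_fact J); intros Hl. split.
      - apply Rinv_0_lt_compat, lt_0_INR, Hl.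
      - rewrite <- Rinv_1. apply Rinv_le_contravar; [lra|]. apply (le_INR 1). lia. }
    assert (Ht : 0 < t) by lra.
    assert (HtJ : 0 < t ^ J) by now apply pow_lt.
    assert (HE : Rabs (ev n x 0 p (ederiv_t J e)) <= M' * Rpower (normn n x) (d - INR J)).
    { apply B'; auto; [lra | rewrite quad_t0; lra | rewrite Rabs_R0; lra]. }
    rewrite Rabs_mult. unfold Rdiv. rewrite (Rabs_pos_eq (t ^ J * _)) by (apply Rmult_le_pos; lra).
    apply Rle_trans with (t ^ J * (M' * Rpower (normn n x) (d - INR J))).
    + apply Rmult_le_compat; auto using Rabs_pos; [apply Rmult_le_pos; lra | nra].
    + replace (d - INR J) with (d - INR K + INR (K - J)) by (rewrite minus_INR by lia; ring).
      rewrite Rpower_plus, Rpower_pow by exact Hx0.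
      replace (t ^ K) with (t ^ J * t ^ (K - J)) by (rewrite <- pow_add; f_equal; lia).
      assert (HP : normn n x ^ (K - J) <= 4 ^ (K - J) * t ^ (K - J)).
      { rewrite <- Rpow_mult_distr. apply pow_incr. lra. }
      replace (M' * 4 ^ (K - J) * (t ^ J * t ^ (K - J)) * Rpower (normn n x) (d - INR K))
        with (t ^ J * (M' * Rpower (normn n x) (d - INR K)) * (4 ^ (K - J) * t ^ (K - J))) by ring.
      replace (t ^ J * (M' * (Rpower (normn n x) (d - INR K) * normn n x ^ (K - J))))
        with (t ^ J * (M' * Rpower (normn n x) (d - INR K)) * normn n x ^ (K - J)) by ring.
      apply Rmult_le_compat_l; auto.
      apply Rmult_le_pos; [lra|]. apply Rmult_le_pos; auto. left; apply Rpower_pos.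
Qed.

(** * Local bounds on annuli *)

Lemma Rpower_annulus (rho N d : R) :
  0 < rho -> rho / 2 <= N <= 2 * rho -> Rpower N d <= Rpower (rho / 2) d + Rpower (2 * rho) d.
Proof.
  intros Hrho Hr.
  generalize (Rpower_pos (rho / 2) d), (Rpower_pos (2 * rho) d); intros P1 P2.
  destruct (Rle_dec 0 d) as [Hd|Hd].
  - generalize (Rle_Rpower_l N (2 * rho) d Hd). lra.
  - generalize (Rpower_le_neg (rho / 2) N (- d)). rewrite Ropp_involutive. lra.
Qed.

(** The annulus contains the ball of radius [rho / 2] about every point of norm [rho], so bounds on
    it serve for derivatives and continuity at that point. *)
Definition loc_bounded (n : nat) (g : (nat -> R) -> R) : Prop :=
  forall rho, 0 < rho -> exists M, 0 <= M /\
    forall x, punct n x -> rho / 2 <= normn n x <= 2 * rho -> Rabs (g x) <= M.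

Lemma loc_bounded_ev (n : nat) (e : expr) (d t p : R) :
  (0 < n)%nat -> hom e d -> 1 < p <= 2 -> loc_bounded n (fun x => ev n x t p e).
Proof.
  intros Hn H Hp rho Hrho.
  (* [kappa] comes from [quad_ge_sq]; [tau] is chosen so that the fixed [|t|] is at most [tau |x|]
     on the annulus. *)
  destruct (hom_bound n e d (1 - / p) (Rabs t / (rho / 2))) as (M & HM & B); auto.
  - assert (/ p < 1) by (rewrite <- Rinv_1; apply Rinv_lt_contravar; lra). lra.
  - apply Rmult_le_pos; [apply Rabs_pos | left; apply Rinv_0_lt_compat; lra].
  - exists (M * (Rpower (rho / 2) d + Rpower (2 * rho) d)). split.
    { apply Rmult_le_pos; auto. generalize (Rpower_pos (rho / 2) d), (Rpower_pos (2 * rho) d). lra. }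
    intros x Hx Hr. eapply Rle_trans; [apply (B x t p); auto; [lra| |]|].
    + apply quad_ge_sq; auto; lra.
    + apply Rle_trans with (Rabs t / (rho / 2) * (rho / 2)); [right; field; lra|].
      apply Rmult_le_compat_l; [|lra].
      apply Rmult_le_pos; [apply Rabs_pos | left; apply Rinv_0_lt_compat; lra].
    + apply Rmult_le_compat_l; auto. now apply Rpower_annulus.
Qed.

Lemma loc_bounded_add (n : nat) (f g : (nat -> R) -> R) :
  loc_bounded n f -> loc_bounded n g -> loc_bounded n (fun x => f x + g x).
Proof.
  intros Hf Hg rho Hr. destruct (Hf rho Hr) as (M1 & H1 & B1), (Hg rho Hr) as (M2 & H2 & B2).
  exists (M1 + M2). split; [lra|]. intros x Hx Hn.
  eapply Rle_trans; [apply Rabs_triang|]. apply Rplus_le_compat; auto.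
Qed.

Lemma loc_bounded_scal (n : nat) (c : R) (f : (nat -> R) -> R) :
  loc_bounded n f -> loc_bounded n (fun x => c * f x).
Proof.
  intros Hf rho Hr. destruct (Hf rho Hr) as (M & H & B).
  exists (Rabs c * M). split; [apply Rmult_le_pos; auto using Rabs_pos|]. intros x Hx Hn.
  rewrite Rabs_mult. apply Rmult_le_compat_l; auto using Rabs_pos.
Qed.

Lemma loc_bounded_rem (n K : nat) (e : expr) (d t p : R) :
  (0 < n)%nat -> hom e d -> 1 < p <= 2 -> loc_bounded n (fun x => remainder n K x t p e).
Proof.
  intros Hn H Hp. unfold remainder, Rminus.
  apply loc_bounded_add; [now apply loc_bounded_ev with d|].
  unfold taylor_part. induction K as [|K IH].
  - intros rho Hr. exists 0. split; [lra|]. intros. simpl. rewrite Ropp_0, Rabs_R0. lra.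
  - intros rho Hr.
    destruct (IH rho Hr) as (M1 & H1 & B1).
    destruct (loc_bounded_scal n (t ^ K / INR (fact K)) _
      (loc_bounded_ev n (ederiv_t K e) (d - INR K) 0 p Hn (hom_edt K e d H) Hp) rho Hr) as (M2 & H2 & B2).
    exists (M1 + M2). split; [lra|]. intros x Hx Hxr. cbn [sumn_R].
    rewrite Ropp_plus_distr. eapply Rle_trans; [apply Rabs_triang|].
    apply Rplus_le_compat; [now apply B1 | rewrite Rabs_Ropp; now apply B2].
Qed.

(** * Series of bubbles *)

(** The shift by one makes the total weight 1, so a termwise bound [M * half_pow j] sums to exactly
    [M]. *)
Definition half_pow (j : nat) : R := (1 / 2) ^ S j.

Lemma eps_pos (j : nat) : 0 < half_pow j.
Proof. apply pow_lt; lra. Qed.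

Lemma is_series_eps : is_series half_pow 1.
Proof.
  assert (Hq : Rabs (1 / 2) < 1) by (rewrite Rabs_pos_eq; lra).
  generalize (is_series_scal (1 / 2) _ _ (is_series_geom (1 / 2) Hq)).
  match goal with |- is_series _ ?l -> _ => replace l with 1 end; [exact (fun H => H)|].
  unfold scal; simpl; unfold mult; simpl. change_R. field.
Qed.

Lemma ex_series_dom (a : nat -> R) (M : R) :
  (forall j, Rabs (a j) <= M * half_pow j) -> ex_series a.
Proof.
  intros H. apply (@ex_series_le R_AbsRing R_CompleteNormedModule a (fun j => M * half_pow j)); [exact H|].
  apply (ex_series_scal_l M half_pow). exists 1; exact is_series_eps.
Qed.

Lemma Series_M_eps (M : R) : Series (fun j => M * half_pow j) = M.
Proof. rewrite Series_scal_l, (is_series_unique _ _ is_series_eps). ring. Qed.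

Lemma Series_abs_dom (a : nat -> R) (M : R) :
  (forall j, Rabs (a j) <= M * half_pow j) -> Rabs (Series a) <= M.
Proof.
  intros H. rewrite <- (Series_M_eps M).
  assert (E : ex_series (fun j => M * half_pow j)).
  { apply (ex_series_scal_l M half_pow). exists 1; exact is_series_eps. }
  eapply Rle_trans.
  - apply Series_Rabs. apply ex_series_dom with M. intros j. now rewrite Rabs_Rabsolu.
  - apply Series_le; auto. intros j. split; [apply Rabs_pos | apply H].
Qed.

Lemma Series_ge_term (a : nat -> R) (i : nat) :
  (forall j, 0 <= a j) -> ex_series a -> a i <= Series a.
Proof.
  intros Ha He. rewrite (Series_incr_n a (S i)); auto with arith. simpl pred.
  assert (H1 : 0 <= Series (fun k => a (S i + k)%nat)).
  { replace 0 with (Series (fun _ => 0)).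
    - apply Series_le; [|now apply -> (ex_series_incr_n a (S i))].
      intros; split; [lra | apply Ha].
    - apply is_series_unique. rewrite <- (Rmult_0_l 1).
      apply is_series_ext with (fun j => scal 0 (half_pow j)).
      + intros j. unfold scal; simpl; unfold mult; simpl. change_R. ring.
      + apply (is_series_scal 0 half_pow 1 is_series_eps). }
  assert (H2 : a i <= sum_f_R0 a i).
  { destruct i as [|i]; simpl; [lra|]. generalize (cond_pos_sum a i Ha). lra. }
  lra.
Qed.

(* The second derivatives have a summable bound, so the second-order Taylor estimate can be
   summed; no uniform convergence theorem is needed. *)
Lemma Series_derive (g g1 g2 : nat -> R -> R) (x r M0 M1 M2 : R) :
  0 < r ->
  (forall j y, Rabs (y - x) <= r -> derivable_pt_lim (g j) y (g1 j y)) ->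
  (forall j y, Rabs (y - x) <= r -> derivable_pt_lim (g1 j) y (g2 j y)) ->
  (forall j y, Rabs (y - x) <= r -> Rabs (g j y) <= M0 * half_pow j) ->
  (forall j y, Rabs (y - x) <= r -> Rabs (g1 j y) <= M1 * half_pow j) ->
  (forall j y, Rabs (y - x) <= r -> Rabs (g2 j y) <= M2 * half_pow j) ->
  derivable_pt_lim (fun y => Series (fun j => g j y)) x (Series (fun j => g1 j x)).
Proof.
  intros Hr D1 D2 B0 B1 B2 e He.
  assert (HM : 0 <= M2).
  { assert (Hx : Rabs (x - x) <= r) by (rewrite Rminus_diag, Rabs_R0; lra).
    specialize (B2 O x Hx). generalize (eps_pos 0), (Rabs_pos (g2 O x)). nra. }
  (* The denominator [M2 + 1] covers the case [M2 = 0]. *)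
  assert (Hd : 0 < Rmin r (e / (M2 + 1))).
  { apply Rmin_glb_lt; auto. apply Rdiv_lt_0_compat; lra. }
  exists (mkposreal _ Hd). intros h Hh Hhd. simpl in Hhd.
  assert (Hhr : Rabs h <= r) by (eapply Rle_trans; [left; exact Hhd | apply Rmin_l]).
  assert (Hhe : Rabs h < e / (M2 + 1)) by (eapply Rlt_le_trans; [exact Hhd | apply Rmin_r]).
  assert (Hxx : Rabs (x - x) <= r) by (rewrite Rminus_diag, Rabs_R0; lra).
  assert (Hxh : Rabs (x + h - x) <= r) by (replace (x + h - x) with h by ring; auto).
  assert (E0 : ex_series (fun j => g j x)) by (apply ex_series_dom with M0; auto).
  assert (E1 : ex_series (fun j => g j (x + h))) by (apply ex_series_dom with M0; auto).
  assert (E2 : ex_series (fun j => h * g1 j x)).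
  { apply (ex_series_scal_l h (fun j => g1 j x)). apply ex_series_dom with M1; auto. }
  replace ((Series (fun j => g j (x + h)) - Series (fun j => g j x)) / h - Series (fun j => g1 j x))
    with (Series (fun j => g j (x + h) - g j x - h * g1 j x) / h).
  2:{ rewrite Series_minus, Series_minus, Series_scal_l; auto; [field; auto|].
      now apply (ex_series_minus (fun j => g j (x + h)) (fun j => g j x)). }
  unfold Rdiv. rewrite Rabs_mult, Rabs_inv.
  assert (Hpos : 0 < Rabs h) by now apply Rabs_pos_lt.
  apply Rle_lt_trans with (M2 * Rabs h ^ 2 * / Rabs h).
  - apply Rmult_le_compat_r; [left; now apply Rinv_0_lt_compat|].
    apply Series_abs_dom. intros j.
    generalize (taylor_bound 2 (fun k => match k with O => g j | 1%nat => g1 j | _ => g2 j end)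
      x (x + h) (M2 * half_pow j) r).
    cbv beta. replace (x + h - x) with h by ring. simpl sumn_R. intros HT.
    replace (g j (x + h) - g j x - h * g1 j x) with
      (g j (x + h) - (0 + 1 / 1 * g j x + h * 1 / 1 * g1 j x)) by field.
    replace (M2 * Rabs h ^ 2 * half_pow j) with (M2 * half_pow j * Rabs h ^ 2) by ring.
    apply HT; auto.
    intros [|[|k]] z Hk Hz; [now apply D1 | now apply D2 | lia].
  - replace (M2 * Rabs h ^ 2 * / Rabs h) with (M2 * Rabs h) by (field; lra).
    apply Rle_lt_trans with ((M2 + 1) * Rabs h); [nra|].
    apply Rmult_lt_reg_r with (/ (M2 + 1)); [apply Rinv_0_lt_compat; lra|].
    replace ((M2 + 1) * Rabs h * / (M2 + 1)) with (Rabs h) by (field; lra). exact Hhe.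
Qed.

(** The bound on [A j * t j ^ K] makes the far remainders summable, [t j <= 1 / (j+1)] leaves
    finitely many bubbles close to any given annulus, and [1 < p j <= 2] encodes
    [0 < r_j <= t_j]. *)
Definition admissible (K : nat) (A t p : nat -> R) : Prop :=
  forall j, 0 < A j /\ A j * t j ^ K <= half_pow j /\ 0 < t j <= / INR (S j) /\ 1 < p j <= 2.

Definition bubbles (n K : nat) (A t p : nat -> R) (e : expr) (x : nat -> R) : R :=
  Series (fun j => A j * remainder n K x (t j) (p j) e).

(** On a fixed annulus all but finitely many [j] fall under [rem_far] with one constant; the others
    are bounded one by one, without uniformity. *)
Lemma bubble_bound (n K : nat) (A t p : nat -> R) (e : expr) (d rho : R) :
  (0 < n)%nat -> admissible K A t p -> hom e d -> 0 < rho ->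
  exists M, 0 <= M /\ forall x j, punct n x -> rho / 2 <= normn n x <= 2 * rho ->
    Rabs (A j * remainder n K x (t j) (p j) e) <= M * half_pow j.
Proof.
  intros Hn Hadm H Hrho.
  destruct (rem_far n K e d Hn H) as (M0 & HM0 & B0).
  set (B := Rpower (rho / 2) (d - INR K) + Rpower (2 * rho) (d - INR K)).
  assert (HB : 0 < B).
  { unfold B. generalize (Rpower_pos (rho / 2) (d - INR K)), (Rpower_pos (2 * rho) (d - INR K)). lra. }
  (* For [j >= J] this gives [t j <= rho / 8], hence [4 * t j <= rho / 2 <= |x|]. *)
  destruct (archimed_cor1 (rho / 8)) as (J & HJ & HJ0); [lra|].
  assert (Hfar : forall x j, (J <= j)%nat -> punct n x -> rho / 2 <= normn n x <= 2 * rho ->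
    Rabs (A j * remainder n K x (t j) (p j) e) <= M0 * B * half_pow j).
  { intros x j Hj Hx Hr. destruct (Hadm j) as (HA & HAt & Ht & Hp).
    assert (Htj : t j <= rho / 8).
    { eapply Rle_trans; [apply Ht|]. eapply Rle_trans; [|left; exact HJ].
      apply Rinv_le_contravar; [apply lt_0_INR; lia | apply le_INR; lia]. }
    rewrite Rabs_mult, (Rabs_pos_eq (A j)) by lra.
    apply Rle_trans with (A j * (M0 * t j ^ K * B)).
    - apply Rmult_le_compat_l; [lra|]. eapply Rle_trans; [apply B0; auto; lra|].
      apply Rmult_le_compat_l; [|now apply Rpower_annulus].
      apply Rmult_le_pos; auto. apply pow_le; lra.
    - replace (A j * (M0 * t j ^ K * B)) with (M0 * B * (A j * t j ^ K)) by ring.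
      apply Rmult_le_compat_l; auto. apply Rmult_le_pos; lra. }
  assert (Hnear : forall J0, exists M, 0 <= M /\
    forall x j, (j < J0)%nat -> punct n x -> rho / 2 <= normn n x <= 2 * rho ->
    Rabs (A j * remainder n K x (t j) (p j) e) <= M * half_pow j).
  { induction J0 as [|J0 IH]; [exists 0; split; [lra | intros; lia]|].
    destruct IH as (M1 & H1 & B1). destruct (Hadm J0) as (HA & HAt & Ht & Hp).
    destruct (loc_bounded_scal n (A J0) _ (loc_bounded_rem n K e d (t J0) (p J0) Hn H Hp) rho Hrho)
      as (M2 & H2 & B2).
    generalize (eps_pos J0); intros He.
    (* Dividing by [half_pow J0] turns the plain bound on one bubble into the weighted form. *)
    exists (M1 + M2 / half_pow J0). split.
    { apply Rplus_le_le_0_compat; auto. apply Rmult_le_pos; auto. left; now apply Rinv_0_lt_compat. }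
    intros x j Hj Hx Hr. destruct (Nat.eq_dec j J0) as [->|Hne].
    - eapply Rle_trans; [now apply B2|].
      replace ((M1 + M2 / half_pow J0) * half_pow J0) with (M1 * half_pow J0 + M2) by (field; lra).
      assert (0 <= M1 * half_pow J0) by (apply Rmult_le_pos; lra). lra.
    - eapply Rle_trans; [apply B1; auto; lia|]. generalize (eps_pos j); intros Hej.
      apply Rmult_le_compat_r; [lra|].
      assert (0 <= M2 / half_pow J0) by (apply Rmult_le_pos; auto; left; now apply Rinv_0_lt_compat). lra. }
  destruct (Hnear J) as (M1 & H1 & B1).
  assert (HMB : 0 <= M0 * B) by (apply Rmult_le_pos; lra).
  exists (M0 * B + M1). split; [lra|]. intros x j Hx Hr. generalize (eps_pos j); intros Hej.
  destruct (Nat.lt_ge_cases j J) as [Hj|Hj].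
  - eapply Rle_trans; [now apply B1|]. apply Rmult_le_compat_r; lra.
  - eapply Rle_trans; [now apply Hfar|]. apply Rmult_le_compat_r; lra.
Qed.

Lemma ex_series_bubbles (n K : nat) (A t p : nat -> R) (e : expr) (d : R) (x : nat -> R) :
  (0 < n)%nat -> admissible K A t p -> hom e d -> punct n x ->
  ex_series (fun j => A j * remainder n K x (t j) (p j) e).
Proof.
  intros Hn Hadm H Hx. pose proof Hx as [_ Hx0].
  destruct (bubble_bound n K A t p e d (normn n x) Hn Hadm H Hx0) as (M & HM & B).
  apply ex_series_dom with M. intros j. apply B; auto; lra.
Qed.

Lemma loc_bounded_bubbles (n K : nat) (A t p : nat -> R) (e : expr) (d : R) :
  (0 < n)%nat -> admissible K A t p -> hom e d -> loc_bounded n (bubbles n K A t p e).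
Proof.
  intros Hn Hadm H rho Hrho.
  destruct (bubble_bound n K A t p e d rho Hn Hadm H Hrho) as (M & HM & B).
  exists M. split; auto. intros x Hx Hr. apply Series_abs_dom. intros j. now apply B.
Qed.

Lemma bubbles_dx (n K i : nat) (A t p : nat -> R) (e : expr) (d : R) :
  (i < n)%nat -> admissible K A t p -> hom e d ->
  partial n i (bubbles n K A t p e) (bubbles n K A t p (ederiv (DX i) e)).
Proof.
  intros Hi Hadm H x Hx. assert (Hn : (0 < n)%nat) by lia.
  pose proof Hx as [_ Hx0]. set (rho := normn n x) in *.
  destruct (bubble_bound n K A t p e d rho Hn Hadm H Hx0) as (M0 & HM0 & B0).
  destruct (bubble_bound n K A t p (ederiv (DX i) e) (d - 1) rho Hn Hadm (hom_ed _ _ _ H) Hx0)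
    as (M1 & HM1 & B1).
  destruct (bubble_bound n K A t p (ederiv (DX i) (ederiv (DX i) e)) (d - 1 - 1) rho Hn Hadm
    (hom_ed _ _ _ (hom_ed _ _ _ H)) Hx0) as (M2 & HM2 & B2).
  assert (HD : forall e j y, Rabs (y - x i) <= rho / 2 ->
    derivable_pt_lim (fun y => A j * remainder n K (upd x i y) (t j) (p j) e) y
      (A j * remainder n K (upd x i y) (t j) (p j) (ederiv (DX i) e))).
  { intros e' j y Hy. destruct (punct_line n i x y (rho / 2) Hi Hx (Rle_refl _) Hy) as [Hp _].
    destruct (Hadm j) as (_ & _ & _ & Hpj).
    apply (derivable_pt_lim_scal (fun y => remainder n K (upd x i y) (t j) (p j) e')).
    generalize (rem_dx n K i (upd x i y) (t j) (p j) e' Hi Hp (proj1 Hpj)).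
    rewrite upd_same. apply derivable_pt_lim_locally_ext with 1; [lra|].
    intros z _. now rewrite upd_upd. }
  unfold bubbles.
  eapply derivable_pt_lim_eq.
  - apply (Series_derive (fun j y => A j * remainder n K (upd x i y) (t j) (p j) e)
      (fun j y => A j * remainder n K (upd x i y) (t j) (p j) (ederiv (DX i) e))
      (fun j y => A j * remainder n K (upd x i y) (t j) (p j) (ederiv (DX i) (ederiv (DX i) e)))
      (x i) (rho / 2) M0 M1 M2); try lra; try (intros; apply HD; assumption);
      intros j y Hy; destruct (punct_line n i x y (rho / 2) Hi Hx (Rle_refl _) Hy) as [Hp Hr]; auto.
  - cbv beta. now rewrite upd_id.
Qed.

(* The background term does not involve the parameters: it is read at [t = 0], where
   [EPow sigma] is [|x|^(-2 sigma)] and the value [2] of [p] is irrelevant. *)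
Definition superposition (n K : nat) (A t p : nat -> R) (e0 e : expr) (x : nat -> R) : R :=
  ev n x 0 2 e0 + bubbles n K A t p e x.

Lemma superposition_dx (n K i : nat) (A t p : nat -> R) (e0 e : expr) (d : R) :
  (i < n)%nat -> admissible K A t p -> hom e d ->
  partial n i (superposition n K A t p e0 e) (superposition n K A t p (ederiv (DX i) e0) (ederiv (DX i) e)).
Proof.
  intros Hi Hadm H x Hx.
  apply (derivable_pt_lim_plus (fun y => ev n (upd x i y) 0 2 e0)).
  - apply ev_dx; auto. apply quad_pos; auto; [lia | lra].
  - now apply bubbles_dx with d.
Qed.

Lemma loc_bounded_family (n N : nat) (df : nat -> (nat -> R) -> R) (rho : R) :
  0 < rho -> (forall i, (i < N)%nat -> loc_bounded n (df i)) ->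
  exists M, 0 <= M /\ forall i z, (i < N)%nat -> punct n z ->
    rho / 2 <= normn n z <= 2 * rho -> Rabs (df i z) <= M.
Proof.
  intros Hrho H. induction N as [|N IH]; [exists 0; split; [lra | intros; lia]|].
  destruct IH as (M1 & H1 & B1); [auto with arith|].
  destruct (H N (Nat.lt_succ_diag_r N) rho Hrho) as (M2 & H2 & B2).
  exists (M1 + M2). split; [lra|]. intros i z Hi Hz Hr.
  destruct (Nat.eq_dec i N) as [->|Hne].
  - specialize (B2 z Hz Hr). lra.
  - assert (Hi' : (i < N)%nat) by lia. specialize (B1 i z Hi' Hz Hr). lra.
Qed.

(* Moves from [x] to [y] one coordinate at a time. *)
Lemma loc_bounded_cont (n : nat) (f : (nat -> R) -> R) (df : nat -> (nat -> R) -> R) :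
  (forall i, (i < n)%nat -> partial n i f (df i)) ->
  (forall i, (i < n)%nat -> loc_bounded n (df i)) -> cont_on n f.
Proof.
  intros Hd Hb x Hx e He. pose proof Hx as [Hin Hx0].
  destruct (loc_bounded_family n n df (normn n x) Hx0 Hb) as (M & HM & B).
  set (L := M * INR n + 1).
  assert (HL : 0 < L) by (unfold L; generalize (Rmult_le_pos _ _ HM (pos_INR n)); lra).
  assert (Hdel : 0 < Rmin (normn n x / 2) (e / L)).
  { apply Rmin_glb_lt; [lra | now apply Rdiv_lt_0_compat]. }
  exists (Rmin (normn n x / 2) (e / L)). split; auto.
  intros y [Hyin Hy0] Hyx.
  assert (Hyx1 : normn n (vsub y x) <= normn n x / 2).
  { generalize (Rmin_l (normn n x / 2) (e / L)). lra. }
  assert (Hyx2 : normn n (vsub y x) < e / L).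
  { generalize (Rmin_r (normn n x / 2) (e / L)). lra. }
  (* The polygonal path: [z k] has the first [k] coordinates of [y] and the remaining ones of
     [x]. *)
  set (z := fun k i => if lt_dec i k then y i else x i).
  (* Each point on the path differs from [x] by no more than [y] does in every coordinate, so the
     path stays in the annulus and avoids the origin. *)
  assert (Hz : forall k s, (k < n)%nat -> Rabs (s - x k) <= Rabs (y k - x k) ->
    punct n (upd (z k) k s) /\
    normn n x / 2 <= normn n (upd (z k) k s) <= 2 * normn n x).
  { intros k s Hk Hs.
    assert (Hr : normn n x / 2 <= normn n (upd (z k) k s) <= 2 * normn n x).
    { apply normn_near with (normn n (vsub y x)); auto using normn_ge0.
      rewrite normn_sq. apply sumn_R_le. intros i _. unfold vsub, upd, z.
      rewrite <- (pow2_abs (y i - x i)), <- pow2_abs. apply pow_incr. split; [apply Rabs_pos|].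
      destruct (Nat.eq_dec i k) as [->|]; auto.
      destruct (lt_dec i k); [lra | rewrite Rminus_diag, Rabs_R0; apply Rabs_pos]. }
    split; auto. split; [|lra]. apply inRn_upd; auto. intros i Hi. unfold z.
    destruct (lt_dec i k); auto. }
  assert (Hstep : forall k, (k <= n)%nat ->
    Rabs (f (z k) - f x) <= sumn_R k (fun i => M * Rabs (y i - x i))).
  { induction k as [|k IH]; intros Hk.
    - replace (z O) with x; [rewrite Rminus_diag, Rabs_R0; simpl; lra|].
      apply functional_extensionality; intros i. unfold z. destruct (lt_dec i 0); [lia | auto].
    - replace (f (z (S k)) - f x) with ((f (z k) - f x) + (f (z (S k)) - f (z k))) by ring.
      cbn [sumn_R]. eapply Rle_trans; [apply Rabs_triang|].
      apply Rplus_le_compat; [apply IH; lia|].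
      assert (Hzk : z k k = x k) by (unfold z; destruct (lt_dec k k); [lia | auto]).
      replace (z (S k)) with (upd (z k) k (y k)).
      2:{ apply functional_extensionality; intros i. unfold z, upd.
          destruct (Nat.eq_dec i k), (lt_dec i k), (lt_dec i (S k)); subst; auto; lia. }
      replace (f (z k)) with (f (upd (z k) k (x k))) by (now rewrite <- Hzk, upd_id).
      apply (mvt_bound (fun s => f (upd (z k) k s)) (fun s => df k (upd (z k) k s))
        (x k) (y k) M (Rabs (y k - x k))); [| |lra].
      + intros s Hs. destruct (Hz k s Hk Hs) as [Hp _].
        generalize (Hd k Hk _ Hp). rewrite upd_same.
        apply derivable_pt_lim_locally_ext with 1; [lra|]. intros; now rewrite upd_upd.
      + intros s Hs. destruct (Hz k s Hk Hs) as [Hp Hr]. now apply B. }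
  specialize (Hstep n (Nat.le_refl n)).
  replace (z n) with y in Hstep.
  (* Beyond index [n] both points vanish, so the path ends exactly at [y]. *)
  2:{ apply functional_extensionality; intros i. unfold z. destruct (lt_dec i n); auto.
      rewrite Hyin, Hin by lia. reflexivity. }
  eapply Rle_lt_trans; [exact Hstep|].
  apply Rle_lt_trans with (M * INR n * normn n (vsub y x)).
  - rewrite sumn_R_scal, Rmult_assoc, <- sumn_R_const. apply Rmult_le_compat_l; auto.
    apply sumn_R_le. intros i Hi. now apply (coord_le_normn n i (vsub y x)).
  - apply Rle_lt_trans with (L * normn n (vsub y x)).
    + apply Rmult_le_compat_r; [apply normn_ge0 | unfold L; lra].
    + apply Rmult_lt_reg_r with (/ L); [now apply Rinv_0_lt_compat|].
      replace (L * normn n (vsub y x) * / L) with (normn n (vsub y x)) by (field; lra).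
      exact Hyx2.
Qed.

(** * Smoothness and Laplacian of the superposition *)

Fixpoint ederivs (l : list nat) (e : expr) : expr :=
  match l with nil => e | cons i l => ederiv (DX i) (ederivs l e) end.

Lemma hom_eds (l : list nat) (e : expr) (d : R) : hom e d -> exists d', hom (ederivs l e) d'.
Proof.
  intros H. induction l as [|i l [d' IH]]; [now exists d|].
  exists (d' - 1). now apply hom_ed.
Qed.

(** Every iterated partial derivative is again a superposition, and it is continuous because its own
    first partials are locally bounded. The background is assumed locally bounded directly, since a
    constant plus a power is not homogeneous. *)
Lemma superposition_smooth (n K : nat) (A t p : nat -> R) (e0 e : expr) (d : R) :
  admissible K A t p -> hom e d ->
  (forall l, loc_bounded n (fun x => ev n x 0 2 (ederivs l e0))) ->
  smooth_on n (superposition n K A t p e0 e).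
Proof.
  intros Hadm H H0 l Hl.
  assert (Hpart : forall l i, (i < n)%nat -> partial n i
    (superposition n K A t p (ederivs l e0) (ederivs l e))
    (superposition n K A t p (ederivs (i :: l) e0) (ederivs (i :: l) e))).
  { intros l' i Hi. destruct (hom_eds l' e d H) as [d' H']. now apply superposition_dx with d'. }
  exists (superposition n K A t p (ederivs l e0) (ederivs l e)). split.
  - induction Hl as [|i l Hi Hl IH]; [apply ip_nil|].
    apply ip_cons with (superposition n K A t p (ederivs l e0) (ederivs l e)); auto.
  - apply loc_bounded_cont with
      (fun i => superposition n K A t p (ederivs (i :: l) e0) (ederivs (i :: l) e)); auto.
    intros i Hi. destruct (hom_eds (i :: l) e d H) as [d' H'].
    apply loc_bounded_add; [apply H0|]. apply loc_bounded_bubbles with d'; auto. lia.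
Qed.

Lemma Series_sumn_R (N : nat) (a : nat -> nat -> R) :
  (forall i, (i < N)%nat -> ex_series (a i)) ->
  is_series (fun j => sumn_R N (fun i => a i j)) (sumn_R N (fun i => Series (a i))).
Proof.
  induction N as [|N IH]; intros H; simpl.
  - generalize (is_series_scal 0 half_pow 1 is_series_eps).
    match goal with |- is_series _ ?l -> _ => replace l with 0 by (symmetry; apply Rmult_0_l) end.
    apply is_series_ext. intros j. apply Rmult_0_l.
  - apply (is_series_plus (fun j => sumn_R N (fun i => a i j)) (a N)).
    + apply IH. auto with arith.
    + apply Series_correct, H. auto with arith.
Qed.

Lemma superposition_lap (n K : nat) (A t p : nat -> R) (e0 e0' e e' : expr) (d : R) :
  (0 < n)%nat -> admissible K A t p -> hom e d ->
  (forall x, punct n x ->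
    ev n x 0 2 e0' = sumn_R n (fun i => ev n x 0 2 (ederiv (DX i) (ederiv (DX i) e0)))) ->
  eqv n e' (esum n (fun i => ederiv (DX i) (ederiv (DX i) e))) ->
  is_lap n (superposition n K A t p e0 e) (superposition n K A t p e0' e').
Proof.
  intros Hn Hadm H H0 H1.
  exists (fun i => superposition n K A t p (ederiv (DX i) (ederiv (DX i) e0)) (ederiv (DX i) (ederiv (DX i) e))).
  split.
  - intros i Hi. exists (superposition n K A t p (ederiv (DX i) e0) (ederiv (DX i) e)). split.
    + now apply superposition_dx with d.
    + apply superposition_dx with (d - 1); auto using hom_ed.
  - intros x Hx. unfold superposition. rewrite sumn_R_add, <- H0 by auto. f_equal.
    unfold bubbles.
    rewrite <- (is_series_unique _ _ (Series_sumn_R n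
      (fun i j => A j * remainder n K x (t j) (p j) (ederiv (DX i) (ederiv (DX i) e)))
      (fun i _ => ex_series_bubbles n K A t p _ _ x Hn Hadm (hom_ed _ _ _ (hom_ed _ _ _ H)) Hx))).
    apply Series_ext. intros j. destruct (Hadm j) as (_ & _ & _ & Hp).
    rewrite (rem_eqv n K x (t j) (p j) e' _ Hn H1 Hx (proj1 Hp)).
    now rewrite rem_esum, sumn_R_scal.
Qed.

(** * The iterated Laplacian of a bubble *)

(** This is [|grad Q|^2 = 4 |x - t e_0|^2 = 4 (Q - r^2)]; in this form the Laplacian of a power of
    [Q] is a combination of powers of [Q]. *)
Lemma sum_dq_sq (n : nat) (x : nat -> R) (t p : R) :
  (0 < n)%nat ->
  sumn_R n (fun i => ev n x t p (equad_deriv (DX i)) ^ 2) = 4 * (quad n x t p - (p - 1) * t ^ 2).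
Proof.
  intros Hn. unfold quad.
  rewrite (sumn_R_ext n _ (fun i => 4 * x i ^ 2 + (4 * t ^ 2 - 8 * t * x 0%nat) * kron i 0)).
  - rewrite sumn_R_add, !sumn_R_scal.
    replace (sumn_R n (fun i => kron i 0)) with 1; [unfold sq; ring|].
    destruct n as [|n]; [lia|]. clear. induction n as [|n IH].
    + simpl. unfold kron. simpl. ring.
    + cbn [sumn_R] in *. rewrite <- IH. unfold kron. simpl. ring.
  - intros i _. simpl. unfold kron. destruct (Nat.eq_dec i 0) as [->|]; ring.
Qed.

Lemma Rpower_succ (x y : R) : 0 < x -> x * Rpower x (- (y + 1)) = Rpower x (- y).
Proof.
  intros Hx. rewrite <- (Rpower_1 x Hx) at 1. rewrite <- Rpower_plus. f_equal. ring.
Qed.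

(** The chain rule with Laplacian [2 n] of [Q] and [sum_dq_sq] for the gradient; the part [4 Q] of
    the latter merges with the first term. *)
Lemma lap_pow (n : nat) (x : nat -> R) (t p sigma : R) :
  (0 < n)%nat -> 0 < quad n x t p ->
  sumn_R n (fun i => ev n x t p (ederiv (DX i) (ederiv (DX i) (EPow sigma)))) =
  2 * sigma * (2 * sigma + 2 - INR n) * Rpower (quad n x t p) (- (sigma + 1)) -
  4 * sigma * (sigma + 1) * ((p - 1) * t ^ 2) * Rpower (quad n x t p) (- (sigma + 1 + 1)).
Proof.
  intros Hn HQ. pose proof (Rpower_succ _ (sigma + 1) HQ) as E.
  set (P1 := Rpower (quad n x t p) (- (sigma + 1))) in *.
  set (P2 := Rpower (quad n x t p) (- (sigma + 1 + 1))) in *.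
  rewrite (sumn_R_ext n _ (fun i => - 2 * sigma * P1 +
    sigma * (sigma + 1) * P2 * ev n x t p (equad_deriv (DX i)) ^ 2)).
  - rewrite sumn_R_add, sumn_R_const, sumn_R_scal, sum_dq_sq by auto. rewrite <- E. ring.
  - intros i _. cbn [ederiv ev]. fold P1 P2.
    replace (ev n x t p (ederiv (DX i) (equad_deriv (DX i)))) with 2; [ring|].
    simpl. unfold kron. destruct (Nat.eq_dec i i); [ring | congruence].
Qed.

(* [(p - 1) t^2 = r^2]. *)
Definition ebeta : expr := EMul (EAdd EP (ECst (-1))) (EMul ET ET).

Definition ebeta_pow (l : nat) : expr := Nat.iter l (EMul ebeta) (ECst 1).

Lemma ev_ebpow (n : nat) (x : nat -> R) (t p : R) (l : nat) :
  ev n x t p (ebeta_pow l) = ((p - 1) * t ^ 2) ^ l.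
Proof.
  induction l as [|l IH]; [reflexivity|].
  change (ebeta_pow (S l)) with (EMul ebeta (ebeta_pow l)). cbn [ev]. rewrite IH. simpl. ring.
Qed.

Lemma ev_dx_ebpow (n : nat) (x : nat -> R) (t p : R) (i l : nat) :
  ev n x t p (ederiv (DX i) (ebeta_pow l)) = 0.
Proof.
  induction l as [|l IH]; [reflexivity|].
  change (ebeta_pow (S l)) with (EMul ebeta (ebeta_pow l)). cbn [ev ederiv]. rewrite IH. simpl. ring.
Qed.

Lemma hom_ebpow (l : nat) : hom (ebeta_pow l) (2 * INR l).
Proof.
  induction l as [|l IH].
  - apply hom_eq with 0; [apply hom_cst | simpl; ring].
  - change (ebeta_pow (S l)) with (EMul ebeta (ebeta_pow l)). apply hom_Mul with 2 (2 * INR l); auto.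
    + apply hom_Mul with 0 2; [|apply hom_Mul with 1 1; [apply hom_T | apply hom_T | ring]|ring].
      apply hom_Add; constructor.
    + rewrite S_INR. ring.
Qed.

Definition term (c : R) (l : nat) (sigma : R) : expr :=
  EMul (EMul (ECst c) (ebeta_pow l)) (EPow sigma).

Lemma ev_term (n : nat) (x : nat -> R) (t p c : R) (l : nat) (sigma : R) :
  ev n x t p (term c l sigma) = c * ((p - 1) * t ^ 2) ^ l * Rpower (quad n x t p) (- sigma).
Proof. unfold term. cbn [ev]. now rewrite ev_ebpow. Qed.

Lemma hom_term (c : R) (l : nat) (sigma : R) :
  0 < sigma -> hom (term c l sigma) (2 * INR l - 2 * sigma).
Proof.
  intros H. apply hom_Mul with (2 * INR l) (-2 * sigma); [|now apply hom_Pow|ring].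
  apply hom_Mul with 0 (2 * INR l); auto using hom_cst, hom_ebpow. ring.
Qed.

Lemma lap_term (n : nat) (x : nat -> R) (t p c : R) (l : nat) (sigma : R) :
  (0 < n)%nat -> punct n x -> 1 < p ->
  sumn_R n (fun i => ev n x t p (ederiv (DX i) (ederiv (DX i) (term c l sigma)))) =
  c * (2 * sigma * (2 * sigma + 2 - INR n)) * ((p - 1) * t ^ 2) ^ l *
    Rpower (quad n x t p) (- (sigma + 1)) -
  c * (4 * sigma * (sigma + 1)) * ((p - 1) * t ^ 2) ^ S l *
    Rpower (quad n x t p) (- (sigma + 1 + 1)).
Proof.
  intros Hn Hx Hp. pose proof (quad_pos n x t p Hn Hx Hp) as HQ.
  rewrite (sumn_R_ext n _ (fun i => c * ((p - 1) * t ^ 2) ^ l *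
    ev n x t p (ederiv (DX i) (ederiv (DX i) (EPow sigma))))).
  - rewrite sumn_R_scal, lap_pow by auto. simpl pow. ring.
  - intros i Hi.
    assert (E : ev n x t p (ederiv (DX i) (ederiv (DX i) (ebeta_pow l))) = 0).
    { apply (eqv_ed n (DX i) (ederiv (DX i) (ebeta_pow l)) (ECst 0)); auto.
      intros y s q _ _. now rewrite ev_dx_ebpow. }
    unfold term. set (P := EPow sigma). cbn [ederiv ev]. rewrite E, ev_dx_ebpow, ev_ebpow. ring.
Qed.

(** * Coefficients of the iterated Laplacian *)

Fixpoint poch (s : R) (k : nat) : R :=
  match k with O => 1 | S k => poch s k * (s + INR k) end.

Lemma poch_pos (s : R) (k : nat) : 0 < s -> 0 < poch s k.
Proof.
  intros Hs. induction k as [|k IH]; simpl; [lra|].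
  apply Rmult_lt_0_compat; auto. generalize (pos_INR k). lra.
Qed.

(* [lapc m k l] equals [binom k l * (m-1-l) (m-2-l) ... (m-k)]. *)
Fixpoint lapc (m k l : nat) : R :=
  match k with
  | O => match l with O => 1 | S _ => 0 end
  | S k => (INR m - 1 - INR k - INR l) * lapc m k l +
           match l with O => 0 | S l => lapc m k l end
  end.

Lemma lapc_above (m k l : nat) : (k < l)%nat -> lapc m k l = 0.
Proof.
  revert l. induction k as [|k IH]; intros [|l] H; simpl; try lia; auto.
  rewrite (IH (S l)), (IH l) by lia. ring.
Qed.

Lemma lapc_diag (m k : nat) : lapc m k k = 1.
Proof.
  induction k as [|k IH]; auto. simpl lapc. rewrite lapc_above, IH by lia. ring.
Qed.

(** The ratio of neighbouring entries in the closed form, cross-multiplied so that vanishing factors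
    cause no division. *)
Lemma lapc_ratio (m k l : nat) :
  (INR k - INR l) * lapc m k l = (INR l + 1) * (INR m - 1 - INR l) * lapc m k (S l).
Proof.
  revert l. induction k as [|k IH]; intros l.
  - destruct l; simpl; ring.
  - change (lapc m (S k) (S l)) with
      ((INR m - 1 - INR k - INR (S l)) * lapc m k (S l) + lapc m k l).
    specialize (IH l) as E1. rewrite !S_INR. rewrite Rmult_plus_distr_l.
    replace ((INR l + 1) * (INR m - 1 - INR l) *
      ((INR m - 1 - INR k - (INR l + 1)) * lapc m k (S l))) with
      ((INR m - 1 - INR k - (INR l + 1)) *
      ((INR l + 1) * (INR m - 1 - INR l) * lapc m k (S l))) by ring.
    rewrite <- E1. destruct l as [|l]; cbn [lapc]; [simpl; ring|].
    specialize (IH l) as E2. rewrite !S_INR in *.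
    replace ((INR k + 1 - (INR l + 1)) * ((INR m - 1 - INR k - (INR l + 1)) * lapc m k (S l) + lapc m k l))
      with ((INR k + 1 - (INR l + 1)) * ((INR m - 1 - INR k - (INR l + 1)) * lapc m k (S l)) +
       (INR k - INR l) * lapc m k l) by ring.
    rewrite E2. ring.
Qed.

(** Downward induction on [l], written as [m - 1 - j]: at [l = m - 1] the factor [m - 1 - l] in
    [lapc_ratio] is zero, and the zero propagates to smaller [l]. This cancellation leaves a single
    term in the [m]-th Laplacian. *)
Lemma lapc_below (m l : nat) : (l < m)%nat -> lapc m m l = 0.
Proof.
  intros H. replace l with (m - 1 - (m - 1 - l))%nat by lia.
  assert (Hj : (m - 1 - l <= m - 1)%nat) by lia. revert Hj. generalize (m - 1 - l)%nat.
  induction n as [|j IH]; intros Hj;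
    [generalize (lapc_ratio m m (m - 1 - 0)) | generalize (lapc_ratio m m (m - 1 - S j))];
    intros E.
  - replace (INR m - 1 - INR (m - 1 - 0)) with 0 in E
      by (rewrite Nat.sub_0_r, minus_INR by lia; simpl; ring).
    replace (INR m - INR (m - 1 - 0)) with 1 in E
      by (rewrite Nat.sub_0_r, minus_INR by lia; simpl; ring).
    lra.
  - replace (S (m - 1 - S j)) with (m - 1 - j)%nat in E by lia.
    rewrite IH, Rmult_0_r in E by lia.
    apply Rmult_integral in E. destruct E as [E|E]; auto.
    assert (INR (m - 1 - S j) < INR m) by (apply lt_INR; lia). lra.
Qed.

(* [Delta^k Q^(-s)]. *)
Definition elap (m : nat) (s : R) (k : nat) : expr :=
  esum (S k) (fun l => term ((-4) ^ k * poch s (k + l) * lapc m k l) l (s + INR k + INR l)).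

Lemma hom_elap (m : nat) (s : R) (k : nat) : 0 < s -> hom (elap m s k) (-2 * s - 2 * INR k).
Proof.
  intros Hs. apply hom_esum. intros l _.
  apply hom_eq with (2 * INR l - 2 * (s + INR k + INR l)); [|ring].
  apply hom_term. generalize (pos_INR k), (pos_INR l). lra.
Qed.

Lemma sumn_R_shift (N : nat) (w : nat -> R) :
  sumn_R (S N) (fun l => match l with O => 0 | S l => w l end) = sumn_R N w.
Proof. induction N as [|N IH]; [simpl; ring|]. cbn [sumn_R] in *. rewrite IH. reflexivity. Qed.

(** The relation [2 s = n - 2 m] turns the factor [2 sigma + 2 - n] at [sigma = s + k + l] into
    [-2 (m - 1 - k - l)]. The two terms of [lap_term] then reproduce the recursion of [lapc]. *)
Lemma elap_step (n m : nat) (s : R) (k : nat) :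
  (0 < n)%nat -> 2 * s = INR n - 2 * INR m ->
  eqv n (elap m s (S k)) (esum n (fun i => ederiv (DX i) (ederiv (DX i) (elap m s k)))).
Proof.
  intros Hn Hs x t p Hx Hp. unfold elap at 1. rewrite !ev_esum.
  rewrite (sumn_R_ext n _ (fun i => sumn_R (S k) (fun l => ev n x t p (ederiv (DX i) (ederiv (DX i)
    (term ((-4) ^ k * poch s (k + l) * lapc m k l) l (s + INR k + INR l))))))).
  2:{ intros i _. unfold elap. now rewrite !ed_esum, ev_esum. }
  rewrite sumn_R_swap.
  set (b := (p - 1) * t ^ 2). set (Q := quad n x t p).
  (* [w] collects the contributions that raise the power of [r^2] by one, [u] those that keep it. *)
  set (w := fun l => (-4) ^ S k * poch s (S k + S l) * lapc m k l * b ^ S l *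
        Rpower Q (- (s + INR (S k) + INR (S l)))).
  set (u := fun l => (-4) ^ S k * poch s (S k + l) * ((INR m - 1 - INR k - INR l) * lapc m k l) *
        b ^ l * Rpower Q (- (s + INR (S k) + INR l))).
  rewrite (sumn_R_ext (S (S k)) _ (fun l => u l + match l with O => 0 | S l => w l end)).
  - rewrite sumn_R_add, sumn_R_shift.
    (* The additional entry of [u] at [l = k + 1] lies above the diagonal and vanishes. *)
    replace (sumn_R (S (S k)) u) with (sumn_R (S k) u).
    2:{ change (sumn_R (S (S k)) u) with (sumn_R (S k) u + u (S k)).
        unfold u at 3. rewrite lapc_above by lia. ring. }
    rewrite <- sumn_R_add. apply sumn_R_ext. intros l _.
    rewrite lap_term by auto. fold b Q.
    replace (s + INR k + INR l + 1) with (s + INR (S k) + INR l) by (rewrite S_INR; ring).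
    replace (s + INR (S k) + INR l + 1) with (s + INR (S k) + INR (S l)) by (rewrite (S_INR l); ring).
    unfold u, w. replace (S k + S l)%nat with (S (S (k + l))) by lia.
    replace (S k + l)%nat with (S (k + l)) by lia.
    replace (2 * (s + INR k + INR l) + 2 - INR n) with (-2 * (INR m - 1 - INR k - INR l)) by lra.
    cbn [poch]. rewrite !S_INR, plus_INR. simpl pow. ring.
  - intros l _. rewrite ev_term. fold b Q. unfold u, w. cbn [lapc]. destruct l; ring.
Qed.

Lemma elap_top (n m : nat) (s : R) :
  eqv n (elap m s m) (term ((-4) ^ m * poch s (2 * m)) m (s + 2 * INR m)).
Proof.
  intros x t p Hx Hp. unfold elap. rewrite ev_esum. cbn [sumn_R].
  rewrite sumn_R_0.
  - rewrite !ev_term, lapc_diag. replace (m + m)%nat with (2 * m)%nat by lia.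
    replace (s + INR m + INR m) with (s + 2 * INR m) by ring. ring.
  - intros l Hl. rewrite ev_term, lapc_below by auto. ring.
Qed.

(** * Vanishing of the Taylor coefficients after [m] Laplacians *)

Definition etpow (j : nat) : expr := Nat.iter j (EMul ET) (ECst 1).

Lemma ev_etpow (n : nat) (x : nat -> R) (t p : R) (j : nat) : ev n x t p (etpow j) = t ^ j.
Proof.
  induction j as [|j IH]; [reflexivity|].
  change (etpow (S j)) with (EMul ET (etpow j)). cbn [ev]. now rewrite IH.
Qed.

Lemma ev_dt_etpow (n : nat) (x : nat -> R) (t p : R) (j : nat) :
  ev n x t p (ederiv DT (etpow (S j))) = INR (S j) * t ^ j.
Proof.
  induction j as [|j IH]; [simpl; ring|].
  change (ederiv DT (etpow (S (S j)))) with
    (EAdd (EMul (ECst 1) (etpow (S j))) (EMul ET (ederiv DT (etpow (S j))))).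
  cbn [ev]. rewrite IH, ev_etpow, (S_INR (S j)). simpl pow. ring.
Qed.

(** Each derivative in [t] costs at most one of the explicit factors [t]. *)
Lemma edt_vanish (n k j : nat) (e g : expr) :
  (0 < n)%nat -> eqv n e (EMul (etpow (j + k)) g) ->
  exists g', eqv n (ederiv_t k e) (EMul (etpow j) g').
Proof.
  intros Hn. revert j. induction k as [|k IH]; intros j H.
  - exists g. now rewrite Nat.add_0_r in H.
  - destruct (IH (S j)) as [g' H'].
    { now replace (S j + k)%nat with (j + S k)%nat by lia. }
    exists (EAdd (EMul (ECst (INR (S j))) g') (EMul ET (ederiv DT g'))).
    intros x t p Hx Hp. rewrite edt_S, (eqv_ed n DT _ _ Hn I H' x t p Hx Hp).
    cbn [ederiv ev]. rewrite ev_dt_etpow, !ev_etpow. simpl pow. ring.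
Qed.

(** With [r^2 = (p - 1) t^2] the term carries the factor [t^(2m)], so its Taylor coefficients of
    order below [2 m] at [t = 0] are zero. Subtracting the Taylor polynomial therefore leaves the
    [m]-th Laplacian of a bubble unchanged. *)
Lemma rem_top (n m K : nat) (x : nat -> R) (t p c sigma : R) :
  (0 < n)%nat -> (K <= 2 * m)%nat -> punct n x -> 1 < p ->
  remainder n K x t p (term c m sigma) = ev n x t p (term c m sigma).
Proof.
  intros Hn HK Hx Hp. unfold remainder, taylor_part. rewrite sumn_R_0; [ring|]. intros k Hk.
  set (e := term c m sigma).
  set (g := EMul (EMul (ECst c) (Nat.iter m (EMul (EAdd EP (ECst (-1)))) (ECst 1))) (EPow sigma)).
  (* The exponent [2 m] is split so that at least one factor [t] survives [k] derivatives. *)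
  assert (H : eqv n e (EMul (etpow (S (2 * m - k - 1) + k)) g)).
  { intros y s q _ _. unfold e, g. rewrite ev_term. cbn [ev]. rewrite ev_etpow.
    replace (S (2 * m - k - 1) + k)%nat with (2 * m)%nat by lia.
    assert (E : ev n y s q (Nat.iter m (EMul (EAdd EP (ECst (-1)))) (ECst 1)) = (q - 1) ^ m).
    { clear. induction m as [|m IH]; simpl; auto. rewrite IH. ring. }
    rewrite E, Rpow_mult_distr, <- pow_mult. ring. }
  destruct (edt_vanish n k _ e g Hn H) as [g' H'].
  rewrite (H' x 0 p Hx Hp). cbn [ev]. rewrite ev_etpow. simpl pow. ring.
Qed.

(** * The differential inequality and the blow-up *)

(** Adding [(M1 + M2) * P * half_pow j] makes every term nonnegative: by [rem_far] away from the
    bubble, by positivity of [e] and [tay_near] close to it. The corrected series then dominates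
    each of its terms, and the correction sums to [(M1 + M2) * P]. *)
Lemma bubbles_lower (n K : nat) (e : expr) (d : R) :
  (0 < n)%nat -> hom e d ->
  (forall x t p, punct n x -> 1 < p -> 0 <= ev n x t p e) ->
  exists M, 0 <= M /\ forall A t p x, admissible K A t p -> punct n x ->
    - (M * Rpower (normn n x) (d - INR K)) <= bubbles n K A t p e x /\
    forall j, normn n x <= 4 * t j ->
      A j * ev n x (t j) (p j) e - M * Rpower (normn n x) (d - INR K) <= bubbles n K A t p e x.
Proof.
  intros Hn H Hpos.
  destruct (rem_far n K e d Hn H) as (M1 & H1 & B1).
  destruct (tay_near n K e d H) as (M2 & H2 & B2).
  exists (M1 + M2). split; [lra|]. intros A t p x Hadm Hx.
  generalize (Rpower_pos (normn n x) (d - INR K)); intros HP.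
  set (P := Rpower (normn n x) (d - INR K)) in *.
  set (b := fun j => A j * remainder n K x (t j) (p j) e + (M1 + M2) * P * half_pow j).
  assert (Hnear : forall j, normn n x <= 4 * t j -> A j * ev n x (t j) (p j) e <= b j).
  { intros j Hj. destruct (Hadm j) as (HA & HAt & Ht & Hp).
    specialize (B2 x (t j) (p j) Hx Hp Hj). apply Rabs_le_between in B2.
    unfold b, remainder. fold P in B2.
    assert (A j * taylor_part n K x (t j) (p j) e <= A j * (M2 * t j ^ K * P)) by (apply Rmult_le_compat_l; lra).
    assert (M2 * P * (A j * t j ^ K) <= M2 * P * half_pow j).
    { apply Rmult_le_compat_l; auto. apply Rmult_le_pos; lra. }
    assert (0 <= M1 * P * half_pow j).
    { apply Rmult_le_pos; [apply Rmult_le_pos; lra | left; apply eps_pos]. }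
    lra. }
  assert (Hb : forall j, 0 <= b j).
  { intros j. destruct (Hadm j) as (HA & HAt & Ht & Hp).
    destruct (Rle_dec (normn n x) (4 * t j)) as [Hj|Hj].
    - eapply Rle_trans; [|now apply Hnear]. apply Rmult_le_pos; [lra|]. apply Hpos; auto; lra.
    - assert (H4 : 4 * t j <= normn n x) by lra. assert (Ht0 : 0 <= t j) by lra.
      specialize (B1 x (t j) (p j) Hx Hp Ht0 H4). apply Rabs_le_between in B1. fold P in B1.
      unfold b.
      assert (A j * - (M1 * t j ^ K * P) <= A j * remainder n K x (t j) (p j) e)
        by (apply Rmult_le_compat_l; lra).
      assert (M1 * P * (A j * t j ^ K) <= M1 * P * half_pow j).
      { apply Rmult_le_compat_l; auto. apply Rmult_le_pos; lra. }
      assert (0 <= M2 * P * half_pow j).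
      { apply Rmult_le_pos; [apply Rmult_le_pos; lra | left; apply eps_pos]. }
      lra. }
  assert (E1 : ex_series (fun j => A j * remainder n K x (t j) (p j) e))
    by now apply ex_series_bubbles with d.
  assert (E2 : ex_series (fun j => (M1 + M2) * P * half_pow j)).
  { apply (ex_series_scal_l ((M1 + M2) * P) half_pow). exists 1. apply is_series_eps. }
  assert (Eb : ex_series b) by now apply (ex_series_plus (fun j => A j * remainder n K x (t j) (p j) e)).
  assert (HS : Series b = bubbles n K A t p e x + (M1 + M2) * P).
  { unfold b, bubbles. rewrite Series_plus, Series_M_eps; auto. }
  split.
  - generalize (Series_ge_term b O Hb Eb), (Hb O). lra.
  - intros j Hj. generalize (Series_ge_term b j Hb Eb), (Hnear j Hj). lra.
Qed.

(** The choice of [r] reads [c0 A = e A^lam r^D]. What remains is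
    [r^(D + 2m) Q^(-s-2m) <= Q^(-s lam)], which is [r^2 <= Q] raised to the nonnegative power
    [s + 2 m - s lam]. *)
Lemma near_estimate (m : nat) (A e r Q s lam D c0 : R) :
  0 < A -> 0 < e -> 0 < r -> r ^ 2 <= Q -> 0 < D -> 0 < c0 ->
  2 * (s + 2 * INR m - s * lam) = D + 2 * INR m ->
  Rpower r D = c0 * Rpower A (1 - lam) / e ->
  A * (c0 * (r ^ 2) ^ m * Rpower Q (- (s + 2 * INR m))) <= e * Rpower (A * Rpower Q (- s)) lam.
Proof.
  intros HA He Hr HQ HD Hc Hk Hrd.
  assert (Hr2 : 0 < r ^ 2) by now apply pow_lt.
  assert (HQ0 : 0 < Q) by lra.
  assert (Ec : c0 = e * Rpower r D * Rpower A (lam - 1)).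
  { rewrite Hrd. replace (lam - 1) with (- (1 - lam)) by ring.
    rewrite Rpower_Ropp. field. generalize (Rpower_pos A (1 - lam)). lra. }
  rewrite <- Rpower_mult_distr, Rpower_mult by auto using Rpower_pos.
  rewrite <- (Rpower_pow m (r ^ 2)) by auto.
  rewrite Rpower_sqr by auto.
  replace (A * (c0 * Rpower r (2 * INR m) * Rpower Q (- (s + 2 * INR m))))
    with (e * (A * Rpower A (lam - 1)) * ((Rpower r D * Rpower r (2 * INR m)) * Rpower Q (- (s + 2 * INR m))))
    by (rewrite Ec; ring).
  rewrite <- (Rpower_1 A HA) at 1. rewrite <- !Rpower_plus, <- Hk, <- Rpower_sqr by auto.
  replace (1 + (lam - 1)) with lam by ring. rewrite Rmult_assoc.
  apply Rmult_le_compat_l; [lra|]. apply Rmult_le_compat_l; [left; apply Rpower_pos|].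
  replace (- s * lam) with ((s + 2 * INR m - s * lam) + - (s + 2 * INR m)) by ring.
  rewrite (Rpower_plus _ _ Q). apply Rmult_le_compat_r; [left; apply Rpower_pos|].
  apply Rle_Rpower_l; [|lra]. generalize (pos_INR m). lra.
Qed.

(** From [r <= t] and [t <= N] one gets [A r^(2m) <= A t^(2m-2) t^2 <= e N^2], and [Q >= N^2 / 2]
    handles the power. *)
Lemma far_estimate (m : nat) (A e r t N Q s c0 : R) :
  (1 <= m)%nat -> 0 < A -> 0 < r <= t -> 4 * t <= N -> 1 / 2 * N ^ 2 <= Q -> 0 < c0 -> 0 < s ->
  A * t ^ (2 * m - 2) <= e ->
  A * (c0 * (r ^ 2) ^ m * Rpower Q (- (s + 2 * INR m))) <=
  e * (c0 * Rpower (1 / 2) (- (s + 2 * INR m)) * Rpower N (- (2 * s + 4 * INR m - 2))).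
Proof.
  intros Hm HA Hr Ht HQ Hc Hs He. generalize (pos_INR m); intros Hm0.
  assert (HN2 : 0 < N ^ 2) by (apply pow_lt; lra).
  assert (H1 : Rpower Q (- (s + 2 * INR m)) <=
    Rpower (1 / 2) (- (s + 2 * INR m)) * Rpower N (- (2 * s + 4 * INR m))).
  { replace (- (2 * s + 4 * INR m)) with (2 * - (s + 2 * INR m)) by ring.
    rewrite <- Rpower_sqr, Rpower_mult_distr by lra. apply Rpower_le_neg; lra. }
  assert (H2 : A * (r ^ 2) ^ m <= e * N ^ 2).
  { apply Rle_trans with (A * (t ^ (2 * m - 2) * t ^ 2)).
    - apply Rmult_le_compat_l; [lra|]. rewrite <- pow_mult, <- pow_add.
      replace (2 * m - 2 + 2)%nat with (2 * m)%nat by lia. apply pow_incr; lra.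
    - rewrite <- Rmult_assoc. apply Rmult_le_compat; auto.
      + apply Rmult_le_pos; [lra | apply pow_le; lra].
      + apply pow_le; lra.
      + apply pow_incr; lra. }
  replace (- (2 * s + 4 * INR m - 2)) with (- (2 * s + 4 * INR m) + INR 2) by (simpl; ring).
  rewrite Rpower_plus, Rpower_pow by lra.
  replace (A * (c0 * (r ^ 2) ^ m * Rpower Q (- (s + 2 * INR m)))) with
    (c0 * ((A * (r ^ 2) ^ m) * Rpower Q (- (s + 2 * INR m)))) by ring.
  replace (e * (c0 * Rpower (1 / 2) (- (s + 2 * INR m)) * (Rpower N (- (2 * s + 4 * INR m)) * N ^ 2)))
    with (c0 * ((e * N ^ 2) * (Rpower (1 / 2) (- (s + 2 * INR m)) * Rpower N (- (2 * s + 4 * INR m))))) by ring.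
  apply Rmult_le_compat_l; [lra|]. apply Rmult_le_compat; auto.
  - apply Rmult_le_pos; [lra|]. apply pow_le, pow_le; lra.
  - left; apply Rpower_pos.
Qed.

(** For [N >= 1] the constant part suffices; for [N < 1] the singular part does, because
    [beta <= lam * nu]. *)
Lemma background_power (c1 N nu beta lam : R) :
  0 <= c1 -> 0 < N -> 1 <= lam -> 0 <= beta <= lam * nu ->
  c1 * Rpower N (- beta) <= Rpower (1 + c1 + (1 + c1) * Rpower N (- nu)) lam.
Proof.
  intros Hc HN Hl Hb. generalize (Rpower_pos N (- nu)); intros HP.
  assert (H1 : 1 + c1 <= Rpower (1 + c1) lam).
  { rewrite <- (Rpower_1 (1 + c1)) at 1 by lra. apply Rle_Rpower; lra. }
  destruct (Rle_dec 1 N) as [H|H].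
  - apply Rle_trans with (Rpower (1 + c1) lam).
    + assert (Rpower N (- beta) <= 1).
      { rewrite <- (Rpower_O N HN). apply Rle_Rpower; lra. }
      generalize (Rpower_pos N (- beta)). nra.
    + apply Rle_Rpower_l; [lra|]. nra.
  - apply Rle_trans with (Rpower ((1 + c1) * Rpower N (- nu)) lam).
    + rewrite <- Rpower_mult_distr, Rpower_mult by lra.
      apply Rmult_le_compat; [lra | left; apply Rpower_pos | lra |].
      unfold Rpower.
      assert (ln N < 0) by (rewrite <- ln_1; apply ln_increasing; lra).
      destruct (Req_dec (- beta * ln N) (- nu * lam * ln N)) as [->|Hne]; [lra|].
      left. apply exp_increasing. nra.
    + apply Rle_Rpower_l; [lra|]. split; [apply Rmult_lt_0_compat; lra | nra].
Qed.

(** With [A = e / t^K] the equation for [r] forces [r = B1 t^g], [g = K (lam - 1) / D]. Since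
    [g > 1], small [t] gives [r <= t]. The product [A r^(-2s) t^(K + 2sg)] does not depend on [t],
    so small [t] also makes [phi t * N] smaller than it. *)
Lemma scale_choice (K : nat) (phi : R -> R) (lam D s c0 e delta N : R) :
  1 < lam -> 0 < D < INR K * (lam - 1) -> 0 < c0 -> 0 < e -> 0 < delta -> 0 < N ->
  (forall ep, 0 < ep -> exists de, 0 < de /\ forall r, 0 < r < de -> Rabs (phi r) < ep) ->
  exists t r, 0 < t < delta /\ 0 < r <= t /\
    Rpower r D = c0 * Rpower (e / t ^ K) (1 - lam) / e /\
    phi t * N < e / t ^ K * Rpower r (- (2 * s)) * Rpower t (INR K + 2 * s * (INR K * (lam - 1) / D)).
Proof.
  intros Hl HD Hc He Hdel HN Hphi.
  set (g := INR K * (lam - 1) / D).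
  assert (Hg : 1 < g).
  { unfold g. apply Rmult_lt_reg_r with D; [lra|]. unfold Rdiv. rewrite Rmult_assoc, Rinv_l; lra. }
  set (B := c0 * Rpower e (1 - lam) / e).
  assert (HB : 0 < B).
  { unfold B. apply Rdiv_lt_0_compat; auto. apply Rmult_lt_0_compat; auto using Rpower_pos. }
  set (B1 := Rpower B (/ D)). assert (HB1 : 0 < B1) by apply Rpower_pos.
  set (k := e * Rpower B1 (- (2 * s)) / N).
  assert (Hk : 0 < k).
  { unfold k. apply Rdiv_lt_0_compat; auto. apply Rmult_lt_0_compat; auto using Rpower_pos. }
  destruct (Hphi k Hk) as (de & Hde & Hphik).
  (* The value of [t] at which [B1 t^g = t]. *)
  set (t1 := Rpower (/ B1) (/ (g - 1))).
  assert (Ht1 : 0 < t1) by apply Rpower_pos.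
  set (t := Rmin t1 (Rmin delta de) / 2).
  assert (Ht : 0 < t /\ t < t1 /\ t < delta /\ t < de).
  { unfold t. generalize (Rmin_l t1 (Rmin delta de)), (Rmin_r t1 (Rmin delta de)),
      (Rmin_l delta de), (Rmin_r delta de). intros.
    assert (0 < Rmin t1 (Rmin delta de)) by (repeat apply Rmin_glb_lt; auto). lra. }
  destruct Ht as (Ht & Htt1 & Htd & Htde). clearbody t.
  exists t, (B1 * Rpower t g). split; [lra|]. split; [split|split].
  - apply Rmult_lt_0_compat; auto using Rpower_pos.
  - replace g with ((g - 1) + 1) by ring. rewrite Rpower_plus, Rpower_1 by auto.
    rewrite <- Rmult_assoc. apply Rle_trans with (1 * t); [|lra]. apply Rmult_le_compat_r; [lra|].
    apply Rle_trans with (B1 * Rpower t1 (g - 1)).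
    + apply Rmult_le_compat_l; [lra|]. apply Rle_Rpower_l; lra.
    + unfold t1. rewrite Rpower_mult, Rinv_l, Rpower_1 by (try apply Rinv_0_lt_compat; lra).
      rewrite Rinv_r; lra.
  - rewrite <- Rpower_mult_distr by auto using Rpower_pos.
    unfold B1. rewrite !Rpower_mult, Rinv_l, Rpower_1 by lra.
    unfold Rdiv. rewrite <- Rpower_mult_distr; [|lra|apply Rinv_0_lt_compat, pow_lt; lra].
    rewrite <- Rpower_pow, <- Rpower_Ropp, Rpower_mult by auto.
    replace (g * D) with (- INR K * (1 - lam)) by (unfold g; field; lra).
    unfold B. field. lra.
  - rewrite <- Rpower_mult_distr, Rpower_mult by auto using Rpower_pos. fold g.
    rewrite <- (Rpower_pow K t Ht). unfold Rdiv. rewrite <- Rpower_Ropp.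
    replace (e * Rpower t (- INR K) * (Rpower B1 (- (2 * s)) * Rpower t (g * - (2 * s))) *
      Rpower t (INR K + 2 * s * g)) with
      (e * Rpower B1 (- (2 * s)) * (Rpower t (- INR K) * Rpower t (g * - (2 * s)) *
      Rpower t (INR K + 2 * s * g))) by ring.
    rewrite <- !Rpower_plus.
    replace (- INR K + g * - (2 * s) + (INR K + 2 * s * g)) with 0 by ring.
    rewrite Rpower_O, Rmult_1_r by auto.
    apply Rlt_le_trans with (k * N).
    + apply Rmult_lt_compat_r; auto. eapply Rle_lt_trans; [apply Rle_abs|]. apply Hphik. lra.
    + unfold k. right. field. lra.
Qed.

(** The first Laplacian annihilates the harmonic background, which is why it is peeled off; from
    then on the background is zero. *)
Lemma superposition_iter_lap (n m K : nat) (A t p : nat -> R) (s : R) (e0 : expr) :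
  (0 < n)%nat -> admissible K A t p -> 0 < s -> 2 * s = INR n - 2 * INR m ->
  (forall x, punct n x -> sumn_R n (fun i => ev n x 0 2 (ederiv (DX i) (ederiv (DX i) e0))) = 0) ->
  (1 <= m)%nat ->
  iter_lap n m (superposition n K A t p e0 (elap m s 0)) (superposition n K A t p (ECst 0) (elap m s m)).
Proof.
  intros Hn Hadm Hs Hsn H0 Hm.
  assert (Hlap : forall e0 k, (forall x, punct n x ->
      sumn_R n (fun i => ev n x 0 2 (ederiv (DX i) (ederiv (DX i) e0))) = 0) ->
    is_lap n (superposition n K A t p e0 (elap m s k)) (superposition n K A t p (ECst 0) (elap m s (S k)))).
  { intros e1 k H1. apply superposition_lap with (-2 * s - 2 * INR k); auto using hom_elap, elap_step.
    intros x Hx. now rewrite H1. }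
  assert (Hiter : forall j k,
    iter_lap n j (superposition n K A t p (ECst 0) (elap m s k))
      (superposition n K A t p (ECst 0) (elap m s (k + j)))).
  { induction j as [|j IH]; intros k; [rewrite Nat.add_0_r; apply il_zero|].
    apply il_succ with (superposition n K A t p (ECst 0) (elap m s (S k))).
    - apply Hlap. intros x _. simpl. now apply sumn_R_0.
    - replace (k + S j)%nat with (S k + j)%nat by lia. apply IH. }
  destruct m as [|m']; [lia|].
  apply il_succ with (superposition n K A t p (ECst 0) (elap (S m') s 1)); [now apply Hlap|].
  apply (Hiter m' 1%nat).
Qed.

Lemma elap_bubble (n m : nat) (s : R) (x : nat -> R) (t p : R) :
  ev n x t p (elap m s 0) = Rpower (quad n x t p) (- s).
Proof.
  unfold elap. rewrite ev_esum. cbn [sumn_R]. rewrite ev_term. simpl.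
  replace (s + 0 + 0) with s by ring. ring.
Qed.

Definition axis_point (t : R) : nat -> R := upd (fun _ => 0) 0 t.

Lemma sq_axis_point (n : nat) (t : R) : (0 < n)%nat -> sq n (axis_point t) = t ^ 2.
Proof.
  intros Hn. unfold axis_point. rewrite sq_upd by auto. unfold sq.
  rewrite sumn_R_0 by (intros; simpl; ring). ring.
Qed.

Lemma normn_axis_point (n : nat) (t : R) : (0 < n)%nat -> 0 <= t -> normn n (axis_point t) = t.
Proof.
  intros Hn Ht. unfold normn. fold (sq n (axis_point t)). rewrite sq_axis_point by auto.
  now apply sqrt_pow2.
Qed.

Theorem theorem1p5 (m n : nat) (lam a : R) (phi : R -> R)
  (hm3 : (3 <= m)%nat) (hmodd : Nat.Odd m) (hmn : (2 * m < n)%nat)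
  (hlam1 : INR (2 * m + n - 2) / INR (n - 2) < lam)
  (hlam2 : lam < INR n / INR (n - 2 * m))
  (ha : a = INR (4 * m * (m - 1)) / (INR n - lam * INR (n - 2 * m)))
  (hphi_range : forall r, 0 < r < 1 -> 0 < phi r < 1)
  (hphi_cont : forall r, 0 < r < 1 -> continuity_pt phi r)
  (hphi_lim : forall eps, 0 < eps -> exists delta, 0 < delta /\
      forall r, 0 < r < delta -> Rabs (phi r) < eps) :
  exists u : (nat -> R) -> R,
    smooth_on n u /\
    (forall x, punct n x -> 0 < u x) /\
    (exists w, iter_lap n m u w /\
       forall x, punct n x -> 0 <= - w x <= Rpower (u x) lam) /\
    (forall M delta, 0 < delta -> exists x, punct n x /\ normn n x < delta /\
       M < u x / (phi (normn n x) * Rpower (normn n x) (- a))).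
Proof.
  assert (Hn : (0 < n)%nat) by lia.
  assert (Hm : 3 <= INR m) by (apply (le_INR 3) in hm3; simpl in hm3; lra).
  assert (Hmn : 2 * INR m < INR n).
  { apply lt_INR in hmn. rewrite mult_INR in hmn. simpl in hmn. lra. }
  rewrite minus_INR, mult_INR in hlam2, ha by lia.
  rewrite !minus_INR, plus_INR, mult_INR in hlam1 by lia.
  rewrite !mult_INR, minus_INR in ha by lia.
  simpl INR in hlam1, hlam2, ha.
  replace (1 + 1) with 2 in * by ring. replace (2 + 1 + 1) with 4 in * by ring.
  set (s := (INR n - 2 * INR m) / 2).
  assert (Hs : 0 < s) by (unfold s; lra).
  assert (Hsn : 2 * s = INR n - 2 * INR m) by (unfold s; lra).
  (* This order makes the error [|x|^(-2s-K)] equal to the harmonic [|x|^(2-n)], so the background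
     can absorb it at no cost to the Laplacian. *)
  set (K := (2 * m - 2)%nat).
  assert (HK : INR K = 2 * INR m - 2).
  { unfold K. rewrite minus_INR, mult_INR by lia. simpl. lra. }
  set (D := INR n - lam * (INR n - 2 * INR m)).
  assert (HD : 0 < D).
  { apply Rmult_lt_compat_r with (r := INR n - 2 * INR m) in hlam2; [|lra].
    unfold Rdiv in hlam2. rewrite Rmult_assoc, Rinv_l in hlam2; unfold D; lra. }
  assert (Hlam : 2 * INR m + INR n - 2 < lam * (INR n - 2)).
  { apply Rmult_lt_compat_r with (r := INR n - 2) in hlam1; [|lra].
    unfold Rdiv in hlam1. rewrite Rmult_assoc, Rinv_l in hlam1; lra. }
  assert (Hlam1 : 1 < lam) by nra.
  assert (HDK : D < INR K * (lam - 1)) by (rewrite HK; unfold D; lra).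
  set (c0 := 4 ^ m * poch s (2 * m)).
  assert (Hc0 : 0 < c0).
  { unfold c0. apply Rmult_lt_0_compat; [apply pow_lt; lra | now apply poch_pos]. }
  set (e := elap m s 0).
  assert (He : hom e (-2 * s)).
  { apply hom_eq with (-2 * s - 2 * INR 0); [now apply hom_elap | simpl; ring]. }
  destruct (bubbles_lower n K e (-2 * s) Hn He) as (C0 & HC0 & Hlow).
  { intros x t p _ _. unfold e. rewrite elap_bubble. left. apply Rpower_pos. }
  set (nu := INR n - 2).
  replace (-2 * s - INR K) with (- nu) in Hlow by (unfold nu; lra).
  assert (Hch : forall j, exists tr : R * R,
    (0 < fst tr < / INR (S j) /\ 0 < snd tr <= fst tr) /\
    Rpower (snd tr) D = c0 * Rpower (half_pow j / fst tr ^ K) (1 - lam) / half_pow j /\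
    phi (fst tr) * INR (S j) <
      half_pow j / fst tr ^ K * Rpower (snd tr) (- (2 * s)) * Rpower (fst tr) a).
  { intros j. assert (HSj : 0 < INR (S j)) by (apply lt_0_INR; lia).
    destruct (scale_choice K phi lam D s c0 (half_pow j) (/ INR (S j)) (INR (S j)))
      as (t & r & Ht & Hr & Hrd & Hphi); auto using eps_pos, Rinv_0_lt_compat.
    exists (t, r). simpl fst; simpl snd. split; [auto|]. split; [auto|].
    (* Both sides agree because [D + 2 s (lam - 1) = 2 m]. *)
    replace a with (INR K + 2 * s * (INR K * (lam - 1) / D)); auto.
    rewrite ha. fold D. rewrite Hsn, HK. unfold D. field. fold D. lra. }
  set (tr := fun j => proj1_sig (constructive_indefinite_description _ (Hch j))).
  assert (Htr : forall j, (0 < fst (tr j) < / INR (S j) /\ 0 < snd (tr j) <= fst (tr j)) /\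
    Rpower (snd (tr j)) D = c0 * Rpower (half_pow j / fst (tr j) ^ K) (1 - lam) / half_pow j /\
    phi (fst (tr j)) * INR (S j) <
      half_pow j / fst (tr j) ^ K * Rpower (snd (tr j)) (- (2 * s)) * Rpower (fst (tr j)) a).
  { intros j. unfold tr. apply (proj2_sig (constructive_indefinite_description _ (Hch j))). }
  clearbody tr. clear Hch.
  set (t := fun j => fst (tr j)) in *. set (r := fun j => snd (tr j)) in *.
  set (A := fun j => half_pow j / t j ^ K). set (p := fun j => 1 + (r j / t j) ^ 2).
  assert (Hpt : forall j, (p j - 1) * t j ^ 2 = r j ^ 2).
  { intros j. destruct (Htr j) as [[Ht _] _]. unfold p, t, r. field. lra. }
  assert (Hadm : admissible K A t p).
  { intros j. destruct (Htr j) as [[Ht Hr] _]. fold (t j) in *. fold (r j) in *.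
    assert (HtK : 0 < t j ^ K) by (apply pow_lt; lra).
    assert (Hq : 0 < r j / t j <= 1).
    { split; [apply Rdiv_lt_0_compat; lra|].
      apply Rmult_le_reg_r with (t j); [lra|]. unfold Rdiv. rewrite Rmult_assoc, Rinv_l; lra. }
    repeat split.
    - unfold A. apply Rdiv_lt_0_compat; auto using eps_pos.
    - unfold A. right. field. lra.
    - lra.
    - lra.
    - unfold p. assert (0 < (r j / t j) ^ 2) by (apply pow_lt; lra). lra.
    - unfold p. assert ((r j / t j) ^ 2 <= 1 ^ 2) by (apply pow_incr; lra). lra. }
  set (c1 := c0 * Rpower (1 / 2) (- (s + 2 * INR m))).
  assert (Hc1 : 0 < c1) by (apply Rmult_lt_0_compat; auto using Rpower_pos).
  (* [C0] compensates the lower bound of the bubbles; the two copies of [1 + c1] are what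
     [background_power] requires. *)
  set (e0 := EAdd (ECst (1 + c1)) (EMul (ECst (1 + c1 + C0)) (EPow (nu / 2)))).
  set (u := superposition n K A t p e0 e).
  assert (He0 : forall x, punct n x ->
    ev n x 0 2 e0 = 1 + c1 + (1 + c1 + C0) * Rpower (normn n x) (- nu)).
  { intros x [_ Hx]. unfold e0. cbn [ev]. rewrite quad_t0, <- normn_sq, Rpower_sqr by auto.
    replace (2 * - (nu / 2)) with (- nu) by field. reflexivity. }
  assert (Hu1 : forall x, punct n x ->
    1 + c1 + (1 + c1) * Rpower (normn n x) (- nu) <= u x).
  { intros x Hx. destruct (Hlow A t p x Hadm Hx) as [H _].
    unfold u, superposition. rewrite He0 by auto. lra. }
  assert (Hu2 : forall x j, punct n x -> normn n x <= 4 * t j ->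
    A j * Rpower (quad n x (t j) (p j)) (- s) < u x).
  { intros x j Hx Hj. destruct (Hlow A t p x Hadm Hx) as [_ H]. specialize (H j Hj).
    unfold e in H at 1. rewrite elap_bubble in H.
    unfold u, superposition. rewrite He0 by auto. generalize (Rpower_pos (normn n x) (- nu)).
    intros. nra. }
  assert (Hupos : forall x, punct n x -> 0 < u x).
  { intros x Hx. specialize (Hu1 x Hx). generalize (Rpower_pos (normn n x) (- nu)). nra. }
  exists u. split; [|split; [|split]].
  - apply superposition_smooth with (-2 * s); auto. intros l.
    assert (E : ederivs l e0 = EAdd (ederivs l (ECst (1 + c1)))
      (ederivs l (EMul (ECst (1 + c1 + C0)) (EPow (nu / 2))))).
    { induction l as [|i l IH]; auto. cbn [ederivs]. now rewrite IH. }
    rewrite E. cbn [ev].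
    destruct (hom_eds l (ECst (1 + c1)) 0 (hom_cst _)) as [d1 Hd1].
    destruct (hom_eds l (EMul (ECst (1 + c1 + C0)) (EPow (nu / 2))) (- nu)) as [d2 Hd2].
    { apply hom_Mul with 0 (-2 * (nu / 2)); [apply hom_cst | apply hom_Pow; unfold nu; lra | field]. }
    apply loc_bounded_add; [apply loc_bounded_ev with d1 | apply loc_bounded_ev with d2]; auto; lra.
  - exact Hupos.
  - exists (superposition n K A t p (ECst 0) (elap m s m)). split.
    + apply superposition_iter_lap; auto; [|lia]. intros x Hx.
      rewrite (sumn_R_ext n _ (fun i => (1 + c1 + C0) *
        ev n x 0 2 (ederiv (DX i) (ederiv (DX i) (EPow (nu / 2)))))).
      (* At [sigma = nu / 2] the coefficient [2 sigma + 2 - n] is zero, and [t = 0] removes the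
         second term. *)
      * rewrite sumn_R_scal, lap_pow by (auto; rewrite quad_t0; now apply punct_sq).
        unfold nu. field.
      * intros i _. unfold e0. set (P := EPow (nu / 2)). cbn [ederiv ev]. ring.
    + intros x Hx. pose proof Hx as [_ Hx0].
      set (f := fun j => A j * (c0 * (r j ^ 2) ^ m *
        Rpower (quad n x (t j) (p j)) (- (s + 2 * INR m)))).
      assert (Hw : - superposition n K A t p (ECst 0) (elap m s m) x = Series f).
      { unfold superposition, bubbles. cbn [ev]. rewrite Rplus_0_l, <- Series_opp.
        apply Series_ext. intros j. destruct (Hadm j) as (_ & _ & _ & Hp).
        rewrite (rem_eqv n K x (t j) (p j) _ _ Hn (elap_top n m s) Hx (proj1 Hp)).
        rewrite rem_top by (auto; unfold K; try lia; lra).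
        rewrite ev_term, Hpt. unfold f, c0.
        (* Oddness of [m] gives the sign. *)
        replace ((-4) ^ m) with (- 4 ^ m); [ring|].
        destruct hmodd as [k ->]. replace (-4) with (-1 * 4) by ring.
        rewrite Rpow_mult_distr. replace (2 * k + 1)%nat with (S (2 * k)) at 2 by lia.
        rewrite pow_1_odd. ring. }
      assert (Hf : forall j, 0 <= f j <= Rpower (u x) lam * half_pow j).
      { intros j. destruct (Hadm j) as (HA & HAt & Ht & Hp).
        destruct (Htr j) as [[_ Hr] [Hrd _]]. fold (t j) (r j) in Hr, Hrd. fold (A j) in Hrd.
        assert (Hr2 : 0 < r j ^ 2) by (apply pow_lt; lra).
        split.
        - unfold f. apply Rmult_le_pos; [lra|]. apply Rmult_le_pos; [|left; apply Rpower_pos].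
          apply Rmult_le_pos; [lra | left; now apply pow_lt].
        - rewrite Rmult_comm. destruct (Rle_dec (normn n x) (4 * t j)) as [Hj|Hj].
          (* Close to the bubble, [u] dominates [A_j F_j] itself; farther away the background alone
             bounds the term. *)
          + eapply Rle_trans.
            * apply near_estimate with (D := D) (lam := lam) (e := half_pow j);
                auto using eps_pos; [lra| |unfold D, s; lra].
              rewrite <- Hpt. now apply quad_bubble.
            * apply Rmult_le_compat_l; [left; apply eps_pos|].
              apply Rle_Rpower_l; [lra|]. split; [|left; now apply Hu2].
              apply Rmult_lt_0_compat; auto using Rpower_pos.
          + eapply Rle_trans.
            * apply far_estimate with (t := t j) (N := normn n x) (e := half_pow j);
                auto; try lia; try lra.
              unfold quad. rewrite normn_sq. generalize (coord_le_normn n 0 x Hn).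
              intros H1. apply Rabs_le_between in H1.
              assert (t j * x 0%nat <= normn n x / 4 * normn n x).
              { apply Rle_trans with (t j * normn n x); [apply Rmult_le_compat_l; lra|].
                apply Rmult_le_compat_r; lra. }
              generalize (normn_sq n x), (pow2_ge_0 (t j)). nra.
            * fold c1. apply Rmult_le_compat_l; [left; apply eps_pos|].
              eapply Rle_trans; [apply (background_power c1 (normn n x) nu _ lam); auto; try lra|].
              (* Here [n + 2 m - 2 <= lam (n - 2)], the lower bound on [lam], is used. *)
              -- unfold nu. rewrite Hsn. lra.
              -- apply Rle_Rpower_l; [lra|]. split; [|now apply Hu1].
                 generalize (Rpower_pos (normn n x) (- nu)). nra. }
      rewrite Hw. split.
      * apply Rle_trans with (f O); [apply Hf|].
        apply Series_ge_term; [intros; apply Hf|].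
        apply ex_series_dom with (Rpower (u x) lam). intros j. rewrite Rabs_pos_eq; apply Hf.
      * eapply Rle_trans; [apply Rle_abs|]. apply Series_abs_dom.
        intros j. rewrite Rabs_pos_eq; apply Hf.
  - intros M delta Hdelta.
    (* A large index puts the centre within [delta] and makes [j + 1], the factor won in the choice
       of [t_j], exceed [M]. *)
    destruct (archimed_cor1 (Rmin delta (/ (Rabs M + 1)))) as (j & Hj & Hj0).
    { apply Rmin_glb_lt; auto. apply Rinv_0_lt_compat. generalize (Rabs_pos M). lra. }
    assert (HSj : / INR (S j) <= / INR j).
    { apply Rinv_le_contravar; [apply lt_0_INR; lia | apply le_INR; lia]. }
    assert (HSj0 : 1 <= INR (S j)) by (apply (le_INR 1); lia).
    destruct (Hadm j) as (HA & HAt & _ & Hp).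
    destruct (Htr j) as [[Ht Hr] [Hrd Hphi]]. fold (t j) (r j) in *. fold (A j) in *.
    (* The centre of the [j]-th bubble, where [Q = r_j^2]. *)
    exists (axis_point (t j)).
    assert (Hnorm : normn n (axis_point (t j)) = t j) by (apply normn_axis_point; auto; lra).
    assert (Hx : punct n (axis_point (t j))).
    { split; [|lra]. intros i Hi. unfold axis_point. apply upd_other. lia. }
    rewrite Hnorm. split; auto. split.
    + generalize (Rmin_l delta (/ (Rabs M + 1))). lra.
    + assert (Ht1 : 0 < t j < 1).
      { split; [lra|]. apply Rlt_le_trans with (/ INR (S j)); [lra|].
        rewrite <- Rinv_1. apply Rinv_le_contravar; lra. }
      generalize (hphi_range (t j) Ht1); intros Hphi1.
      assert (HM : M < INR (S j)).
      { assert (H1 : / INR (S j) < / (Rabs M + 1)).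
        { generalize (Rmin_r delta (/ (Rabs M + 1))). lra. }
        apply Rinv_lt_cancel in H1; [|lra]. generalize (Rle_abs M). lra. }
      assert (Hta : 0 < Rpower (t j) (- a)) by apply Rpower_pos.
      apply Rmult_lt_reg_r with (phi (t j) * Rpower (t j) (- a)).
      { apply Rmult_lt_0_compat; lra. }
      unfold Rdiv. rewrite (Rmult_assoc (u _)), Rinv_l, Rmult_1_r by nra.
      eapply Rlt_trans; [|apply (Hu2 _ j Hx); lra].
      assert (HQ : quad n (axis_point (t j)) (t j) (p j) = r j ^ 2).
      { unfold quad. rewrite sq_axis_point by auto. unfold axis_point. rewrite upd_same, <- Hpt. ring. }
      rewrite HQ, Rpower_sqr by lra. replace (2 * - s) with (- (2 * s)) by ring.
      apply Rlt_trans with (phi (t j) * INR (S j) * Rpower (t j) (- a)).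
      * replace (M * (phi (t j) * Rpower (t j) (- a))) with (phi (t j) * Rpower (t j) (- a) * M) by ring.
        replace (phi (t j) * INR (S j) * Rpower (t j) (- a))
          with (phi (t j) * Rpower (t j) (- a) * INR (S j)) by ring.
        apply Rmult_lt_compat_l; auto. apply Rmult_lt_0_compat; lra.
      * apply Rlt_le_trans with
          (A j * Rpower (r j) (- (2 * s)) * Rpower (t j) a * Rpower (t j) (- a)).
        -- apply Rmult_lt_compat_r; auto.
        -- rewrite Rmult_assoc, <- Rpower_plus, Rplus_opp_r, Rpower_O by lra. lra.
Qed.
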